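(* Let $f$ be a Lévy exponent whose Lévy measure $V$ belongs to $\mathscr{M}(0^+,2)$. Let $\mathscr{P}_{\mathcal{D}'}$ be the probability measure on $(\mathcal{D}'(\mathbb{R}^d),\mathcal{A}_{\mathcal{D}'})$ with $\int_{\mathcal{D}'}\mathrm{e}^{\mathrm{j}\langle u,\varphi\rangle}\mathrm{d}\mathscr{P}_{\mathcal{D}'}(u)=\exp\left(\int_{\mathbb{R}^d}f(\varphi(\mathbf{r}))\mathrm{d}\mathbf{r}\right)$ for all $\varphi\in\mathcal{D}$, and let $\mathscr{P}_{\mathcal{S}'}$ be the probability measure on $(\mathcal{S}'(\mathbb{R}^d),\mathcal{A}_{\mathcal{S}'})$ with the same formula for all $\varphi\in\mathcal{S}$. Then, identifying $\mathcal{S}'$ with a subset of $\mathcal{D}'$ (so that $\mathcal{A}_{\mathcal{S}'}\subset\mathcal{A}_{\mathcal{D}'}$), we have $\mathscr{P}_{\mathcal{D}'}(A)=\mathscr{P}_{\mathcal{S}'}(A)$ for every $A\in\mathcal{A}_{\mathcal{S}'}$. In particular $\mathscr{P}_{\mathcal{D}'}(\mathcal{S}')=1$ and $\mathscr{P}_{\mathcal{D}'}(\mathcal{D}'\setminus\mathcal{S}')=0$.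
   Context: $\mathcal{D}$: real smooth compactly supported functions on $\mathbb{R}^d$; $\mathcal{S}$: Schwartz space; $\mathcal{D}',\mathcal{S}'$ their duals, with $\mathcal{S}'$ identified with a subset of $\mathcal{D}'$ by restriction. For $\mathcal{N}\in\{\mathcal{D},\mathcal{S}\}$, $\mathcal{A}_{\mathcal{N}'}$ is the $\sigma$-field generated by cylinder sets $\{u\in\mathcal{N}':(\langle u,\varphi_1\rangle,\dots,\langle u,\varphi_N\rangle)\in B\}$, $\varphi_i\in\mathcal{N}$, $B$ Borel in $\mathbb{R}^N$. A Lévy exponent is $f(\omega)=\mathrm{j}\mu\omega-\frac{\sigma^2\omega^2}{2}+\int_{\mathbb{R}\setminus\{0\}}(\mathrm{e}^{\mathrm{j}a\omega}-1-\mathrm{j}\omega a\mathbb{1}_{|a|<1})V(\mathrm{d}a)$ with $\mu\in\mathbb{R}$, $\sigma^2\ge0$, $V$ a Radon measure on $\mathbb{R}\setminus\{0\}$ with $\int\min(1,a^2)V(\mathrm{d}a)<\infty$ (its Lévy measure). $\mathscr{M}(p,q)$ is the set of Radon measures $V$ on $\mathbb{R}\setminus\{0\}$ with $\int_{0<|a|<1}|a|^qV(\mathrm{d}a)<\infty$ and $\int_{|a|\ge1}|a|^pV(\mathrm{d}a)<\infty$; $\mathscr{M}(0^+,2)=\bigcup_{\epsilon>0}\mathscr{M}(\epsilon,2)$. (The measures $\mathscr{P}_{\mathcal{D}'}$ and $\mathscr{P}_{\mathcal{S}'}$ exist and are unique under these hypotheses.) *)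

(* Defs.v *)
From HB Require Import structures.
From mathcomp Require Import all_boot all_order all_algebra.
From mathcomp Require Import all_classical all_reals all_analysis.
Set Implicit Arguments. Unset Strict Implicit. Unset Printing Implicit Defensive.
Import Order.TTheory GRing.Theory Num.Theory.
Import numFieldNormedType.Exports.
Local Open Scope classical_set_scope.
Local Open Scope ring_scope.

Section Distributions.
Variables (R : realType) (d : nat).

Notation pt := 'rV[R]_d.
Definition fnc := pt -> R.
Definition functional := fnc -> R.

Definition ev (i : 'I_d) : pt := delta_mx 0 i.

(* iterated partial derivative d_{s_1} ... d_{s_k} f  (a multi-index of
   order k given as a list of coordinates) *)
Definition pder (s : seq 'I_d) (f : fnc) : fnc :=
  foldr (fun i g => fun x => derive g x (ev i)) f s.

Definition smooth (f : fnc) : Prop :=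
  forall s, continuous (pder s f) /\
            forall (i : 'I_d) (x : pt), derivable (pder s f) x (ev i).

Definition supported_in (K : set pt) (f : fnc) : Prop :=
  forall x, f x != 0 -> K x.

Definition isD (f : fnc) : Prop :=
  smooth f /\ exists K, compact K /\ supported_in K f.

Definition isS (f : fnc) : Prop :=
  smooth f /\ forall (s : seq 'I_d) (n : nat), exists C : R,
    forall x, (1 + `|x|) ^+ n * `|pder s f x| <= C.

Definition linear_on (P : fnc -> Prop) (u : functional) : Prop :=
  forall (a b : R) (f g : fnc), P f -> P g ->
    u (fun x => a * f x + b * g x) = a * u f + b * u g.

(* \mathcal D' : continuous linear functionals on \mathcal D (seminorm
   characterization of continuity, Hormander Def. 2.1.1); a distribution
   is represented by a functional vanishing outside \mathcal D. *)
Definition is_Dprime (u : functional) : Prop :=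
  [/\ forall f, ~ isD f -> u f = 0,
      linear_on isD u &
      forall K : set pt, compact K -> exists (C : R) (N : nat),
        forall f, isD f -> supported_in K f ->
        forall M : R, (forall s x, (size s <= N)%N -> `|pder s f x| <= M) ->
        `|u f| <= C * M].

Definition is_Sprime (u : functional) : Prop :=
  [/\ forall f, ~ isS f -> u f = 0,
      linear_on isS u &
      exists (C : R) (N : nat),
        forall f, isS f ->
        forall M : R, (forall s x, (size s <= N)%N ->
                         (1 + `|x|) ^+ N * `|pder s f x| <= M) ->
        `|u f| <= C * M].

Lemma is_Dprime0 : is_Dprime (fun _ => 0).
Proof.
split => //.
- by move=> a b f g _ _; rewrite !mulr0 addr0.
- move=> K _; exists 0, 0%N => f _ _ M _; by rewrite normr0 mul0r.
Qed.

Lemma is_Sprime0 : is_Sprime (fun _ => 0).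
Proof.
split => //.
- by move=> a b f g _ _; rewrite !mulr0 addr0.
- exists 0, 0%N => f _ M _; by rewrite normr0 mul0r.
Qed.

Definition Dprime := {u : functional | is_Dprime u}.
Definition Sprime := {u : functional | is_Sprime u}.

HB.instance Definition _ := gen_eqMixin Dprime.
HB.instance Definition _ := gen_choiceMixin Dprime.
HB.instance Definition _ := isPointed.Build Dprime (exist _ _ is_Dprime0).
HB.instance Definition _ := gen_eqMixin Sprime.
HB.instance Definition _ := gen_choiceMixin Sprime.
HB.instance Definition _ := isPointed.Build Sprime (exist _ _ is_Sprime0).

Definition borelRN (N : nat) : set (set 'rV[R]_N) :=
  <<s [set O : set 'rV[R]_N | open O] >>.

Definition cylinders (P : fnc -> Prop) (T : Type) (ev_ : T -> functional)
  : set (set T) :=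
  [set A | exists (N : nat) (phi : 'I_N -> fnc) (B : set 'rV[R]_N),
     [/\ forall i, P (phi i), borelRN B &
         A = [set u | B (\row_(i < N) ev_ u (phi i))]]].

Definition cylD : set (set Dprime) := cylinders isD (@proj1_sig _ _).
Definition cylS : set (set Sprime) := cylinders isS (@proj1_sig _ _).

Definition DprimeM := g_sigma_algebraType cylD.
Definition SprimeM := g_sigma_algebraType cylS.

(* identification of S' with a subset of D' : restriction to \mathcal D *)
Definition restrictD (u : functional) : functional :=
  fun f => if `[< isD f >] then u f else 0.

Definition embed_image (A : set SprimeM) : set DprimeM :=
  [set v | exists2 w : Sprime, A w & proj1_sig v = restrictD (proj1_sig w)].

End Distributions.

(* Lebesgue integral over R^d, written as the iterated integral
   \int dx_1 ... \int dx_d g(x_1,...,x_d) *)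
Fixpoint iterated_integral (R : realType) (n : nat) : (n.-tuple R -> R) -> R :=
  match n with
  | 0%N => fun g => g [tuple]
  | n'.+1 => fun g =>
      Rintegral (@lebesgue_measure R) setT
        (fun x => iterated_integral (fun t : n'.-tuple R => g (cons_tuple x t)))
  end.

Definition int_Rd (R : realType) (d : nat) (g : 'rV[R]_d -> R) : R :=
  iterated_integral (fun t : d.-tuple R => g (\row_(i < d) tnth t i)).

Section Levy.
Variables (R : realType).

(* Levy measure: Radon measure on R\{0} (measure on R with no mass at 0,
   finite on compact sets avoiding 0) with \int min(1,a^2) V(da) < oo *)
Definition levy_measure (V : {measure set R -> \bar R}) : Prop :=
  [/\ V [set 0] = 0%E,
      (forall K : set R, compact K -> ~ K 0 -> (V K < +oo)%E) &
      (\int[V]_(a in setT) ((Num.min 1 (a ^+ 2))%R%:E) < +oo)%E].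

Definition in_M (p q : R) (V : {measure set R -> \bar R}) : Prop :=
  (\int[V]_(a in [set a : R | (0 < `|a| < 1)%R]) ((`|a| `^ q)%:E) < +oo)%E /\
  (\int[V]_(a in [set a : R | (1 <= `|a|)%R]) ((`|a| `^ p)%:E) < +oo)%E.

Definition in_M0plus2 (V : {measure set R -> \bar R}) : Prop :=
  exists eps : R, 0 < eps /\ in_M eps 2 V.

(* real and imaginary parts of the Levy exponent
   f(w) = j mu w - sigma2 w^2/2 + \int (e^{jaw} - 1 - j w a 1_{|a|<1}) V(da) *)
Definition levy_re (sigma2 : R) (V : {measure set R -> \bar R}) (w : R) : R :=
  - (sigma2 * w ^+ 2) / 2 +
  Rintegral V setT (fun a => cos (a * w) - 1).

Definition levy_im (mu : R) (V : {measure set R -> \bar R}) (w : R) : R :=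
  mu * w +
  Rintegral V setT (fun a => sin (a * w) - w * (if `|a| < 1 then a else 0)).

End Levy.

(* Main.v *)
(** The two characteristic functionals agree on D, and cosines and sines of the pairings with test
    functions determine a probability on D': finite products of such functions span an algebra,
    and polynomials in them converge boundedly to indicators of finite intersections of
    sets {sin (<u, phi> - c) > 0}, which form a generating pi-system.  Hence P_D' is the image
    of P_S' under the restriction map S' -> D'.  This map is injective, since multiplying by dilated cutoffs
    shows that D is dense in S.  Its range is measurable: v in D' extends to S' if and only if it is
    bounded by C p_N for some Schwartz seminorm p_N, and it is enough to test this on a countable
    subset that is sequentially dense in D.  The inverse map is measurable as a pointwise limit of
    the pairings with the truncated test functions. *)

(* Only one-dimensional data are given: cosine and sine integrals of a single pairing. They become
   joint information because a linear combination of pairings is again a pairing, so product-to-sum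
   formulas keep the algebra inside the known integrals, and no uniqueness theorem for
   characteristic functions on R^N is invoked. Sines appear instead of half-lines because sin(<u,
   phi> - c) lies in the algebra and takes values in [-1, 1], where explicit polynomials approximate
   the indicator of the positive axis; shrinking the argument towards 0 undoes the periodicity
   afterwards.

   The other obstacle is that an injective measurable map need not send measurable sets to
   measurable sets, and that temperedness quantifies over uncountably many test functions.
   Countability comes from rounding: the derivatives of a test function on a finite grid are rounded
   to integers, and one function is chosen from each nonempty class of equal codes, so no explicit
   dense family is built. *)
Require Import Defs.
From HB Require Import structures.
From mathcomp Require Import all_boot all_order all_algebra ring lra.
From mathcomp Require Import all_classical all_reals all_analysis measurable_realfun.
Import Order.TTheory GRing.Theory Num.Theory.
Import numFieldNormedType.Exports.
Local Open Scope classical_set_scope.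
Local Open Scope ring_scope.

(** * Smooth functions: sums, products and dilations *)

Section Calculus.
Set Implicit Arguments.
Unset Strict Implicit.
Context {R : realType} {d : nat}.
Local Notation pt := 'rV[R]_d.
Local Notation fnc := (fnc R d).
Implicit Types (f g : fnc) (s : seq 'I_d) (x : pt).

Definition dp (i : 'I_d) f : fnc := fun x => 'D_(ev R i) f x.

Lemma pder_cons i s f : pder (i :: s) f = dp i (pder s f).
Proof. by []. Qed.

(** The head of the list is the outermost derivative, so removing the last entry differentiates [f]
    first. Inductions with [last_ind] and general [f] then need product and chain rules only for a
    single [dp i]. *)
Lemma pder_rcons i s f : pder (rcons s i) f = pder s (dp i f).
Proof. by rewrite /pder foldr_rcons. Qed.

(** The product rule turns an iterated derivative of a product into a sum over sublists. Recursion
    on the order avoids this: each class is closed under sums and products by induction on [k], with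
    the functions varying. *)
Fixpoint Ck (k : nat) f : Prop :=
  [/\ continuous f, forall i x, derivable f x (ev R i) &
      if k is k'.+1 then forall i, Ck k' (dp i f) else True].

Lemma smooth_dp i f : smooth f -> smooth (dp i f).
Proof. by move=> sf s; rewrite -pder_rcons; exact: sf. Qed.

Lemma smoothP f : smooth f <-> forall k, Ck k f.
Proof.
split.
  move=> sf k; elim: k f sf => [|k IH] f sf; have [cf df] := sf [::]; split => // i.
  exact/IH/smooth_dp.
move=> cf s; elim/last_ind: s f cf => [|s i IH] f cf.
  by case: (cf 0%N).
rewrite pder_rcons; apply: IH => k.
by have [_ _ H] := cf k.+1; exact: H.
Qed.

Lemma CkW k f : Ck k.+1 f -> Ck k f.
Proof.
elim: k f => [|k IH] f; first by move=> [].
by move=> [cf df ddf]; split => // i; exact/IH/ddf.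
Qed.

Lemma Ck_cst k (c : R) : Ck k (fun _ => c).
Proof.
elim: k c => [|k IH] c /=; split=> //.
- exact: cst_continuous.
- exact: cst_continuous.
- move=> i; rewrite (_ : dp _ _ = (fun _ => 0)) //.
  by apply/funext => x; rewrite /dp derive_cst.
Qed.

Lemma CkD k f g : Ck k f -> Ck k g -> Ck k (fun x => f x + g x).
Proof.
elim: k f g => [|k IH] f g [cf df ddf] [cg dg ddg]; split.
- by move=> x; exact: (cvgD (cf x) (cg x)).
- by move=> i x; exact: (derivableD (df i x) (dg i x)).
- exact: I.
- by move=> x; exact: (cvgD (cf x) (cg x)).
- by move=> i x; exact: (derivableD (df i x) (dg i x)).
- move=> i; rewrite (_ : dp _ _ = (fun x => dp i f x + dp i g x)).
    exact: (IH _ _ (ddf i) (ddg i)).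
  by apply/funext => x; exact: (deriveD (df i x) (dg i x)).
Qed.

Lemma dpM i f g x : derivable f x (ev R i) -> derivable g x (ev R i) ->
  dp i (fun x => f x * g x) x = dp i f x * g x + f x * dp i g x.
Proof.
by move=> df dg; rewrite [LHS](deriveM df dg) addrC; congr (_ + _); rewrite mulrC.
Qed.

Lemma CkM k f g : Ck k f -> Ck k g -> Ck k (fun x => f x * g x).
Proof.
elim: k f g => [|k IH] f g Cf Cg; have [cf df ddf] := Cf; have [cg dg ddg] := Cg.
  split; last exact: I.
    by move=> x; exact: (cvgM (cf x) (cg x)).
  by move=> i x; exact: (derivableM (df i x) (dg i x)).
split.
- by move=> x; exact: (cvgM (cf x) (cg x)).
- by move=> i x; exact: (derivableM (df i x) (dg i x)).
- move=> i; rewrite (_ : dp _ _ = (fun x => dp i f x * g x + f x * dp i g x)).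
    exact: (CkD (IH _ _ (ddf i) (CkW Cg)) (IH _ _ (CkW Cf) (ddg i))).
  by apply/funext => x; exact: (dpM (df i x) (dg i x)).
Qed.

Lemma Ck_coord k i : Ck k (fun x : pt => x 0 i).
Proof.
have D x : differentiable (fun x : pt => x 0 i) x by exact: differentiable_coord.
have dc j x : derivable (fun x : pt => x 0 i) x (ev R j) by exact: diff_derivable.
have cc : continuous (fun x : pt => x 0 i).
  by move=> x; exact: coord_continuous.
case: k => [|k]; split => // j.
rewrite (_ : dp _ _ = (fun _ => (j == i)%:R)); first exact: Ck_cst.
apply/funext => x; rewrite /dp /derive; apply: cvg_lim => //.
apply: (@cvg_trans _ ((fun _ : R => (j == i)%:R : R) @ 0^')); last exact: cvg_cst.
apply: near_eq_cvg; near=> h => /=; rewrite !mxE eqxx /= addrK.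
have h0 : h != 0 by near: h; exact: nbhs_dnbhs_neq.
by rewrite [RHS]mulrA (mulVf h0) mul1r eq_sym.
Unshelve. all: by end_near. Qed.

Lemma smooth_cst c : smooth (fun _ : pt => c).
Proof. by apply/smoothP => k; exact: Ck_cst. Qed.

Lemma smoothD f g : smooth f -> smooth g -> smooth (fun x => f x + g x).
Proof. by move=> /smoothP sf /smoothP sg; apply/smoothP => k; exact: CkD. Qed.

Lemma smoothM f g : smooth f -> smooth g -> smooth (fun x => f x * g x).
Proof. by move=> /smoothP sf /smoothP sg; apply/smoothP => k; exact: CkM. Qed.

Lemma smoothZ (a : R) f : smooth f -> smooth (fun x => a * f x).
Proof. exact: (smoothM (smooth_cst a)). Qed.

Lemma smooth_derivable f : smooth f -> forall i x, derivable f x (ev R i).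
Proof. by move=> sf i x; case: (sf [::]) => _; exact. Qed.

Arguments smooth_derivable {f} sf i x.

Lemma smooth_continuous f : smooth f -> continuous f.
Proof. by move=> sf; case: (sf [::]). Qed.

Lemma pder_lin s (a b : R) f g : smooth f -> smooth g ->
  pder s (fun x => a * f x + b * g x) = (fun x => a * pder s f x + b * pder s g x).
Proof.
elim/last_ind: s f g => [//|s i IH] f g sf sg.
rewrite !pder_rcons -IH; [|exact: smooth_dp..].
congr pder; apply/funext => x; rewrite /dp.
have df := smooth_derivable sf i x; have dg := smooth_derivable sg i x.
have dc (c : R) := derivable_cst c x (ev R i).
rewrite (deriveD (derivableM (dc a) df) (derivableM (dc b) dg)).
by rewrite (deriveMl a df) (deriveMl b dg).
Qed.

Lemma pderB s f g : smooth f -> smooth g ->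
  pder s (fun x => f x - g x) = (fun x => pder s f x - pder s g x).
Proof.
move=> sf sg; have := pder_lin s 1 (-1) sf sg.
rewrite (_ : (fun x => 1 * f x + -1 * g x) = (fun x => f x - g x)).
  by move=> ->; apply/funext => x; rewrite mul1r mulN1r.
by apply/funext => x; rewrite mul1r mulN1r.
Qed.

Lemma smoothB f g : smooth f -> smooth g -> smooth (fun x => f x - g x).
Proof.
move=> sf sg; rewrite (_ : (fun x => f x - g x) = (fun x => f x + -1 * g x)).
  exact: (smoothD sf (smoothZ (-1) sg)).
by apply/funext => x; rewrite mulN1r.
Qed.

Lemma derive1_line (f : pt -> R) x v :
  (fun h : R => f (h *: v + x))^`()%classic 0 = 'D_v f x.
Proof.
rewrite derive1E /derive; set g1 := fun h => h^-1 *: _; set g2 := fun h => h^-1 *: _.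
suff -> : g1 = g2 by [].
by rewrite funeqE /g1 /g2 => h /=; rewrite addr0 scale0r add0r [_%:A]mulr1.
Qed.

(** Only a partial derivative is assumed, not differentiability, so the chain rule in several
    variables does not apply. Along the line through [c *: x] the dilation becomes multiplication by
    [c] in one variable. *)
Lemma is_derive_dilate (c : R) i f x : derivable f (c *: x) (ev R i) ->
  is_derive x (ev R i) (fun y => f (c *: y)) (c * dp i f (c *: x)).
Proof.
move=> df.
pose F (h : R) := f (h *: ev R i + c *: x).
have dF : derivable F 0 1 by exact: (derivable1P f (c *: x) (ev R i)).1.
have FE : F^`()%classic 0 = dp i f (c *: x).
  exact: derive1_line.
pose C (h : R) := c * h.
have dC : is_derive (0 : R) 1 C c.
  have -> : C = c \*: id by [].
  by apply: is_derive_eq; rewrite [c *: 1]mulr1.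
have E : (fun h : R => f (c *: (h *: ev R i + x))) = F \o C.
  by apply/funext => h; rewrite /F /C /= scalerDr scalerA.
have C0 : C 0 = 0 by rewrite /C mulr0.
have dFc : derivable F (C 0) 1 by rewrite C0.
have dc : derivable C 0 1 by exact: ex_derive.
have dcomp : derivable (F \o C) 0 1.
  apply: (derivable1_diffP (F \o C) 0).2; apply: differentiable_comp.
    exact: (derivable1_diffP C 0).1.
  by apply: (derivable1_diffP F (C 0)).1; exact: dFc.
apply: DeriveDef.
  by apply: (derivable1P (fun y => f (c *: y)) x (ev R i)).2; rewrite E.
transitivity ((F \o C)^`()%classic 0).
  by rewrite -E (derive1_line (fun y => f (c *: y))).
rewrite (derive1_comp dc dFc) C0 FE mulrC; congr (_ * _).
by rewrite derive1E; exact: derive_val.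
Qed.

Lemma continuous_dilate (c : R) f : continuous f -> continuous (fun x => f (c *: x)).
Proof.
move=> cf x; apply: (@continuous_comp _ _ _ (fun x : pt => c *: x) f); last exact: cf.
exact: scaler_continuous.
Qed.

Lemma dp_dilate (c : R) i f : (forall x, derivable f x (ev R i)) ->
  dp i (fun x => f (c *: x)) = (fun x => c * dp i f (c *: x)).
Proof.
move=> df; apply/funext => x.
by have [_ H] := is_derive_dilate (df (c *: x)); exact: H.
Qed.

Lemma smooth_dilate (c : R) f : smooth f -> smooth (fun x => f (c *: x)).
Proof.
move=> sf; apply/smoothP => k.
elim: k f sf => [|k IH] f sf; have [cf df] := sf [::]; split.
- exact: continuous_dilate.
- by move=> i x; have [H _] := is_derive_dilate (df i (c *: x)); exact: H.
- exact: I.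
- exact: continuous_dilate.
- by move=> i x; have [H _] := is_derive_dilate (df i (c *: x)); exact: H.
- move=> i; rewrite (dp_dilate c (df i)).
  exact: (CkM (Ck_cst k c) (IH _ (smooth_dp i sf))).
Qed.

End Calculus.

Arguments smooth_derivable {R d f} sf i x.

(** * A smooth bump function, and the inclusion of D in S *)

Section Bump.
Set Implicit Arguments.
Unset Strict Implicit.
Context {R : realType} {d : nat}.
Local Notation pt := 'rV[R]_d.
Implicit Types (f : fnc R d) (x : pt).

(* The powers [m] make the family stable under derivation, up to linear combinations. *)
Definition eta (m : nat) (t : R) : R :=
  if 0 < t then t^-1 ^+ m * expR (- t^-1) else 0.

Lemma eta_ge0 m t : 0 <= eta m t.
Proof.
rewrite /eta; case: ifPn => // t0.
by rewrite mulr_ge0 ?expR_ge0// exprn_ge0// invr_ge0 ltW.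
Qed.

(** One term of the exponential series, exp(1/t) >= t^-(m+1)/(m+1)!, leaves a spare factor [t],
    which is what differentiability at 0 requires. *)
Lemma eta_le m t : `|eta m t| <= (m.+1)`!%:R * `|t|.
Proof.
rewrite ger0_norm ?eta_ge0// /eta; case: ifPn => [t0|_]; last first.
  by rewrite mulr_ge0// ler0n.
rewrite (gtr0_norm t0) expRN.
have := @expR_ge1Dxn R t^-1 m; rewrite invr_ge0 (ltW t0) => /(_ isT) H.
have f0 : 0 < (m.+1)`!%:R :> R by rewrite ltr0n fact_gt0.
rewrite ler_pdivrMr ?expR_gt0//.
have : t^-1 ^+ m.+1 / (m.+1)`!%:R <= expR t^-1.
  by apply: le_trans H; rewrite lerDr.
rewrite ler_pdivrMr// => H2.
rewrite -(@ler_pM2l _ t^-1) ?invr_gt0// -exprS (le_trans H2)//.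
set c := _%:R; set E := expR _.
rewrite [leRHS](_ : _ = E * c) //; rewrite /c /E; field.
by rewrite gt_eqF.
Qed.

Lemma eta_is_derive m (t : R) :
  is_derive t 1 (eta m) (- m%:R * eta m.+1 t + eta m.+2 t).
Proof.
have [t0|t0|<-] := ltgtP 0 t.
- have t1 : t != 0 by rewrite gt_eqF.
  pose G (s : R) : R := s^-1 ^+ m * expR (- s^-1).
  have GE : \near t, G t = eta m t.
    by near=> s; rewrite /eta ifT//; near: s; exact: lt_nbhsr.
  have di : is_derive t 1 (fun s : R => s^-1) (- t ^- 2).
    apply: DeriveDef; first exact: derivableV.
    by rewrite deriveV// derive_id [_ *: 1]mulr1.
  have -> : - m%:R * eta m.+1 t + eta m.+2 t =
    (t^-1 ^+ m) *: ((t^-1 ^+ 2) * expR (- t^-1))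
     + expR (- t^-1) *: ((m%:R * t^-1 ^+ m.-1) *: (- t ^- 2)).
    rewrite /eta t0 /GRing.scale /= -exprVn.
    by case: m {G GE} => [|m] /=; rewrite ?exprS; ring.
  have dX := is_deriveX m di.
  have dE : is_derive t 1 (fun s : R => expR (- s^-1)) (t^-1 ^+ 2 * expR (- t^-1)).
    have dN := is_deriveN di.
    have := @is_derive1_comp R expR (fun s => - s^-1) t _ _ (is_derive_expR _) dN.
    by rewrite /GRing.scale /= opprK exprVn mulrC.
  have := is_deriveM dX dE; rewrite exprfctE => dG.
  exact: (near_eq_is_derive GE dG).
- have GE : \near t, (cst 0 : R -> R) t = eta m t.
    near=> s; rewrite /eta ltNge ltW//; near: s; exact: lt_nbhsl.
  have := near_eq_is_derive GE (is_derive_cst (0 : R) t 1).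
  by rewrite /eta !ltNge !(ltW t0)//= mulr0 addr0.
have e0 k : eta k 0 = 0 by rewrite /eta ltxx.
have H : (fun h : R => h^-1 *: ((eta m \o shift 0) (h *: 1) - eta m 0)) @ 0^' --> (0 : R).
  apply: cvg_within_filter => //.
  (* The factor [h^-1] raises the power by one: the difference quotient at 0 is the next member of
     the family, and it tends to 0 by [eta_le]. *)
  have -> : (fun h : R => h^-1 *: ((eta m \o shift 0) (h *: 1) - eta m 0)) = eta m.+1.
    apply/funext => h; rewrite /= e0 subr0 addr0 [h *: 1]mulr1 /eta.
    by case: ifP => _; rewrite /GRing.scale /= ?mulr0// exprS mulrA.
  apply/cvgr0Pnorm_le => e e0'.
  have c0 : 0 < (m.+2)`!%:R :> R by rewrite ltr0n fact_gt0.
  near=> h; apply: (le_trans (eta_le _ _)).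
  rewrite -ler_pdivlMl//.
  near: h.
  have : 0 < (m.+2)`!%:R^-1 * e by rewrite mulr_gt0 ?invr_gt0.
  move=> H; exact: (@nbhs0_le R R^o _ H).
by apply: DeriveDef; [exact: cvgP H|rewrite !e0 mulr0 addr0; exact: (cvg_lim _ H)].
Unshelve. all: by end_near. Qed.

Lemma eta_continuous m : continuous (eta m).
Proof.
move=> t; have [dt _] := eta_is_derive m t.
by apply: differentiable_continuous; apply: (derivable1_diffP (eta m) t).1; exact: dt.
Qed.

Lemma is_derive_comp_line (phi : R -> R) (g : pt -> R) x v (a b : R) :
  is_derive (g x) 1 phi a -> is_derive x v g b ->
  is_derive x v (fun y => phi (g y)) (a * b).
Proof.
move=> dphi [dg gb].
pose G (h : R) : R := g (h *: v + x).
have dG : derivable G 0 1 by exact: (derivable1P g x v).1.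
have dG' : is_derive (0 : R) 1 G b.
  by apply: DeriveDef => //; rewrite -derive1E derive1_line.
have G0 : G 0 = g x by rewrite /G scale0r add0r.
have dphi' : is_derive (G 0) 1 phi a by rewrite G0.
have [dc vc] := is_derive1_comp dphi' dG'.
apply: DeriveDef.
  by apply: (derivable1P (fun y => phi (g y)) x v).2; exact: dc.
by rewrite -(derive1_line (fun y => phi (g y))) derive1E; exact: vc.
Qed.

Definition quad (i : 'I_d) (x : pt) : R := 1 - x 0 i * x 0 i.

Lemma smooth_coord i : smooth (fun x : pt => x 0 i).
Proof. by apply/smoothP => k; exact: Ck_coord. Qed.

Lemma smooth_quad i : smooth (quad i).
Proof.
exact: (smoothB (smooth_cst 1) (smoothM (smooth_coord i) (smooth_coord i))).
Qed.

Lemma Ck_eta_quad k m i : Ck k (fun x => eta m (quad i x)).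
Proof.
have D j n x : is_derive x (ev R j) (fun x => eta n (quad i x))
    ((- n%:R * eta n.+1 (quad i x) + eta n.+2 (quad i x)) * dp j (quad i) x).
  apply: is_derive_comp_line; first exact: eta_is_derive.
  by apply: DeriveDef => //; exact: (smooth_derivable (smooth_quad i)).
have C n : continuous (fun x => eta n (quad i x)).
  move=> x; apply: (@continuous_comp _ _ _ (quad i) (eta n)).
    exact: (smooth_continuous (smooth_quad i)).
  exact: eta_continuous.
elim: k m => [|k IH] m; split.
- exact: C.
- by move=> j x; have [H _] := D j m x; exact: H.
- exact: I.
- exact: C.
- by move=> j x; have [H _] := D j m x; exact: H.
- move=> j; rewrite (_ : dp _ _ = fun x =>
    (- m%:R * eta m.+1 (quad i x) + eta m.+2 (quad i x)) * dp j (quad i) x).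
    apply: CkM; last by apply: (smoothP _).1; exact/smooth_dp/smooth_quad.
    by apply: CkD; [apply: (CkM (Ck_cst k _)); exact: IH|exact: IH].
  by apply/funext => x; have [_ H] := D j m x; exact: H.
Qed.

Lemma smooth_prod (I : Type) (r : seq I) (F : I -> fnc R d) :
  (forall i, smooth (F i)) -> smooth (fun x => \prod_(i <- r) F i x).
Proof.
move=> sF; elim: r => [|i r IH].
  rewrite (_ : (fun x => _) = (fun _ => 1)); first exact: smooth_cst.
  by apply/funext => x; rewrite big_nil.
rewrite (_ : (fun x => _) = (fun x => F i x * \prod_(j <- r) F j x)).
  exact: (smoothM (sF i) IH).
by apply/funext => x; rewrite big_cons.
Qed.

(** The norm of a row is the maximum over its coordinates, so the unit ball is a cube and a product
    of one-variable bumps is supported in it. The factor [expR 1] gives the value 1 at 0; no plateau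
    is arranged, and convergence of truncations will come from continuity at 0. *)
Definition cutoff (x : pt) : R := \prod_i (expR 1 * eta 0 (quad i x)).

Lemma smooth_cutoff : smooth cutoff.
Proof.
apply: smooth_prod => i; apply: smoothZ; apply/smoothP => k; exact: Ck_eta_quad.
Qed.

Lemma cutoff0 : cutoff 0 = 1.
Proof.
rewrite /cutoff big1// => i _.
by rewrite /quad !mxE mulr0 subr0 /eta ltr01 expr0 mul1r invr1 -expRD subrr expR0.
Qed.

Lemma coord_le_norm (x : pt) i : `|x 0 i| <= `|x|.
Proof.
rewrite [leRHS]/Num.Def.normr /= mx_normrE.
by apply/bigmax_geP; right; exists (ord0, i).
Qed.

Lemma norm_le_coord (x : pt) r : 0 <= r -> (forall i, `|x 0 i| <= r) -> `|x| <= r.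
Proof.
move=> r0 H; rewrite [leLHS]/Num.Def.normr /= mx_normrE.
by apply/bigmax_leP; split => // -[i j] _ /=; rewrite ord1.
Qed.

Lemma cutoff_supp : supported_in [set x | `|x| <= 1] cutoff.
Proof.
move=> x; rewrite /cutoff => /prodf_neq0 H /=; apply: norm_le_coord => // i.
have := H i isT; rewrite mulf_eq0 expR_eq0 /= /eta.
case: ifPn; last by rewrite eqxx.
rewrite /quad subr_gt0 => + _.
rewrite -expr2 -real_normK ?num_real// => h.
by rewrite -(@expr_le1 _ 2)// ltW.
Qed.

Lemma compact_ball (r : R) : compact [set x : pt | `|x| <= r].
Proof.
apply: bounded_closed_compact.
  exists r; split; first exact: num_real.
  by move=> M rM x /= xr; apply: (le_trans xr); exact: ltW.
have -> : [set x : pt | `|x| <= r] = (fun x : pt => `|x|) @^-1` [set y | y <= r] by [].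
apply: preimage_closed; last exact: closed_le.
by move=> x _; exact: norm_continuous.
Qed.

Lemma isD_cutoff : isD cutoff.
Proof.
split; first exact: smooth_cutoff.
by exists [set x | `|x| <= 1]; split; [exact: compact_ball|exact: cutoff_supp].
Qed.

Definition in_ball (r : R) (f : fnc R d) := supported_in [set x | `|x| <= r] f.

(** The complement of the closed ball is open, so near an outside point the function is constantly
    0. *)
Lemma in_ball_pder r f s : in_ball r f -> in_ball r (pder s f).
Proof.
move=> fr; elim: s => [//|i s IH] x; apply: contra_neqP => /negP.
rewrite -ltNge => rx.
have op : open [set y : pt | r < `|y|].
  have -> : [set x : pt | r < `|x|] = (fun x : pt => `|x|) @^-1` [set y | r < y] by [].
  apply: open_comp; last exact: open_gt.
  by move=> y _; exact: norm_continuous.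
have E : \near x, pder s f x = cst 0 x.
  near=> y; apply/eqP/negP => /negP /IH /=; apply/negP; rewrite -ltNge.
  by near: y; exact: (open_nbhs_nbhs (conj op rx)).
by rewrite pder_cons /dp (near_eq_derive (ev R i) E) derive_cst.
Unshelve. all: by end_near. Qed.

Lemma isD_in_ball f : isD f -> exists n : nat, in_ball n%:R f.
Proof.
move=> [_ [K [cK Kf]]]; have [M [Mr MK]] := compact_bounded cK.
exists (Num.truncn (`|M| + 1)).+1 => x /Kf Kx /=.
have : `|x| <= `|M| + 1.
  by apply: (MK (`|M| + 1)) => //; rewrite (le_lt_trans (ler_norm M))// ltrDl.
by move=> /le_trans; apply; apply: ltW; exact: truncnS_gt.
Qed.

Lemma in_ball_isD n f : smooth f -> in_ball n f -> isD f.
Proof.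
move=> sf nf; split => //; exists [set x | `|x| <= n]; split => //.
exact: compact_ball.
Qed.

Lemma isD_bounded f : isD f -> forall s, exists C : R, forall x, `|pder s f x| <= C.
Proof.
move=> Df s; have [n fn] := isD_in_ball Df; have [sf _] := Df.
have cont : {within [set x : pt | `|x| <= n%:R], continuous (pder s f)}.
  by apply: continuous_subspaceT; exact: (sf s).1.
have [M [Mr MK]] := compact_bounded (continuous_compact cont (@compact_ball n%:R)).
exists (`|M| + 1) => x.
have M1 : M < `|M| + 1 by rewrite (le_lt_trans (ler_norm M))// ltrDl.
have [/eqP->|] := boolP (pder s f x == 0); first by rewrite normr0 addr_ge0.
move=> /(in_ball_pder fn) xn; apply: (MK _ M1); exists x => //.
Qed.

Lemma isD_isS f : isD f -> isS f.
Proof.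
move=> Df; split=> [|s n]; first by case: Df.
have [m fm] := isD_in_ball Df; have [C HC] := isD_bounded Df s.
exists ((1 + m%:R) ^+ n * C) => x.
have C0 : 0 <= C by apply: le_trans (HC x).
have [/eqP->|] := boolP (pder s f x == 0).
  by rewrite normr0 mulr0 mulr_ge0// exprn_ge0// addr_ge0.
move=> /(in_ball_pder fm) /= xm; apply: ler_pM => //.
by rewrite lerXn2r ?nnegrE ?addr_ge0// lerD2l.
Qed.

End Bump.

(** * Approximation in S by dilated cutoffs *)

Section Cutoff.
Set Implicit Arguments.
Unset Strict Implicit.
Context {R : realType} {d : nat}.
Local Notation pt := 'rV[R]_d.
Implicit Types (f g psi : fnc R d) (x : pt) (s : seq 'I_d).

Definition smooth_bounded psi :=
  smooth psi /\ forall s, exists C : R, forall x, `|pder s psi x| <= C.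

Lemma smooth_bounded_dp i psi : smooth_bounded psi -> smooth_bounded (dp i psi).
Proof.
move=> [sp bp]; split; first exact: smooth_dp.
by move=> s; rewrite -pder_rcons; exact: bp.
Qed.

Lemma isS_dp i f : isS f -> isS (dp i f).
Proof.
move=> [sf bf]; split; first exact: smooth_dp.
by move=> s n; rewrite -pder_rcons; exact: bf.
Qed.

Lemma weight_ge0 x n : 0 <= (1 + `|x|) ^+ n.
Proof. by rewrite exprn_ge0// addr_ge0. Qed.

(** Keeping [psi] general makes the family stable under [dp]: the derivative falls either on [f], or
    on [psi] with an extra factor [c]. *)
Definition dilmul (c : R) psi f : fnc R d := fun x => psi (c *: x) * f x.

Lemma smooth_dilmul c psi f : smooth psi -> smooth f -> smooth (dilmul c psi f).
Proof. by move=> sp sf; exact: (smoothM (smooth_dilate c sp) sf). Qed.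

Lemma dp_dilmul c psi f i : smooth psi -> smooth f ->
  dp i (dilmul c psi f) =
  (fun x => c * dilmul c (dp i psi) f x + 1 * dilmul c psi (dp i f) x).
Proof.
move=> sp sf; apply/funext => x.
rewrite [LHS](dpM (smooth_derivable (smooth_dilate c sp) i x)
  (smooth_derivable sf i x)).
rewrite (dp_dilate c (fun x => smooth_derivable sp i x)).
by rewrite /dilmul mul1r mulrA.
Qed.

Lemma dilmul_bounded psi f s N : smooth_bounded psi -> isS f ->
  exists C : R, forall c x, 0 <= c -> c <= 1 ->
    (1 + `|x|) ^+ N * `|pder s (dilmul c psi f) x| <= C.
Proof.
elim/last_ind: s psi f => [|s i IH] psi f bp Sf.
  have [C HC] := bp.2 [::]; have [D HD] := Sf.2 [::] N.
  exists (C * D) => c x _ _ /=.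
  rewrite /dilmul normrM mulrCA; apply: ler_pM => //.
have [C HC] := IH _ _ (smooth_bounded_dp i bp) Sf.
have [D HD] := IH _ _ bp (isS_dp i Sf).
exists (C + D) => c x c0 c1; rewrite pder_rcons (dp_dilmul _ _ bp.1 Sf.1).
rewrite (pder_lin s c 1 (smooth_dilmul c (smooth_dp i bp.1) Sf.1)
  (smooth_dilmul c bp.1 (smooth_dp i Sf.1))).
rewrite mul1r; apply: (@le_trans _ _ ((1 + `|x|) ^+ N *
   (`|pder s (dilmul c (dp i psi) f) x| + `|pder s (dilmul c psi (dp i f)) x|))).
  apply: ler_wpM2l; first exact: weight_ge0.
  apply: (le_trans (ler_normD _ _)); apply: lerD => //.
  by rewrite normrM ger0_norm// ler_piMl.
by rewrite mulrDr; apply: lerD; [exact: HC|exact: HD].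
Qed.

Lemma dilmul_vanish psi f s N (e : R) : smooth_bounded psi -> isS f -> 0 < e ->
  \forall n \near \oo, forall x,
    n.+1%:R^-1 * ((1 + `|x|) ^+ N * `|pder s (dilmul n.+1%:R^-1 psi f) x|) <= e.
Proof.
move=> bp Sf e0; have [C HC] := dilmul_bounded s N bp Sf.
have C0 : 0 <= C.
  by apply: le_trans (HC 0 0 _ _) => //; rewrite mulr_ge0// weight_ge0.
near=> n => x; have n1 : 0 <= n.+1%:R^-1 :> R by [].
apply: (@le_trans _ _ (n.+1%:R^-1 * C)).
  by apply: ler_wpM2l => //; apply: HC => //; rewrite invf_le1 ?ltr0n// ler1n.
rewrite ler_pdivrMl ?ltr0n// mulrC -ler_pdivrMl//; apply: ltW.
have := truncnS_gt (e^-1 * C) => /lt_le_trans; apply; rewrite ler_nat ltnS.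
by near: n; exists (Num.truncn (e^-1 * C)) => // n /=.
Unshelve. all: by end_near. Qed.

Definition cutoff1 : fnc R d := fun x => cutoff x - 1.

Lemma smooth_cutoff1 : smooth cutoff1.
Proof. exact: (smoothB smooth_cutoff (smooth_cst 1)). Qed.

Lemma cutoff_bounded : smooth_bounded (cutoff : fnc R d).
Proof. by split; [exact: smooth_cutoff|exact: isD_bounded isD_cutoff]. Qed.

Lemma dp_cutoff1 i : dp i cutoff1 = dp i cutoff.
Proof.
apply/funext => x; rewrite /dp [LHS](deriveB (smooth_derivable smooth_cutoff i x)
  (derivable_cst _ _ _)).
by rewrite derive_cst subr0.
Qed.

(** Where [x / n.+1] is small, so is [cutoff1], by continuity at its zero 0. Elsewhere
    [|x| >= del * n.+1], and one spare power of the weight in the decay of [f] supplies a factor of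
    order 1/n. *)
Lemma dilmul_cutoff1_cvg0 f N (e : R) : isS f -> 0 < e ->
  \forall n \near \oo, forall x,
    (1 + `|x|) ^+ N * `|dilmul n.+1%:R^-1 cutoff1 f x| <= e.
Proof.
move=> Sf e0.
have [C HC] := Sf.2 [::] N.+1; rewrite /= in HC.
have C0 : 0 <= C by apply: le_trans (HC 0); rewrite mulr_ge0// weight_ge0.
have [B HB] := cutoff_bounded.2 [::]; rewrite /= in HB.
have B0 : 0 <= B by apply: le_trans (HB 0).
have B1 x : `|cutoff1 x| <= B + 1.
  by rewrite (le_trans (ler_normB _ _))// normr1 lerD.
have eC : 0 < e / (C + 1) by rewrite divr_gt0// ltr_wpDl.
have [del /= del0 Hdel] : exists2 del, 0 < del & forall x, `|x| < del -> `|cutoff1 x| <= e / (C + 1).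
  have : cutoff1 x @[x --> (0 : pt)] --> (0 : R).
    have := @smooth_continuous _ _ _ smooth_cutoff1 (0 : pt).
    by rewrite /continuous_at (_ : cutoff1 0 = 0)// /cutoff1 cutoff0 subrr.
  move=> /cvgr0Pnorm_le /(_ _ eC) /nbhs_normP[del /= del0 H].
  by exists del => // x xd; apply: H; rewrite /ball_ /= sub0r normrN.
have CN x : (1 + `|x|) ^+ N * `|f x| <= C / (1 + `|x|).
  by rewrite ler_pdivlMr ?ltr_pwDl// mulrAC -exprSr; exact: HC.
near=> n => x; have n1 : 0 < n.+1%:R^-1 :> R by rewrite invr_gt0 ltr0n.
rewrite /dilmul normrM mulrCA.
have [xd|xd] := ltP `|n.+1%:R^-1 *: x| del.
  have H1 := Hdel _ xd.
  apply: (@le_trans _ _ (e / (C + 1) * C)); last first.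
    by rewrite mulrAC ler_pdivrMr ?ltr_wpDl// ler_pM2l// lerDl.
  apply: ler_pM => //.
  by apply: (le_trans (CN x)); rewrite ler_pdivrMr ?ltr_pwDl// ler_peMr// lerDl.
rewrite normrZ gtr0_norm// in xd.
apply: (@le_trans _ _ ((B + 1) * (C / (1 + `|x|)))).
  apply: ler_pM => //.
rewrite mulrA ler_pdivrMr ?ltr_pwDl//.
have : (B + 1) * C <= e * (del * n.+1%:R).
  rewrite -ler_pdivrMl// -ler_pdivrMl//; apply: ltW.
  have := truncnS_gt (del^-1 * (e^-1 * ((B + 1) * C))) => /lt_le_trans; apply.
  rewrite ler_nat ltnS.
  by near: n; exists (Num.truncn (del^-1 * (e^-1 * ((B + 1) * C)))) => // n /=.
move=> /le_trans; apply; rewrite ler_pM2l// -ler_pdivlMr ?ltr0n// mulrC.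
by apply: (le_trans xd); rewrite ler_pM2l// lerDr.
Unshelve. all: by end_near. Qed.

(** A derivative falling on [cutoff1] brings a factor 1/(n+1) in front of a bounded family
    ([dilmul_vanish]); one falling on [f] is covered by the induction hypothesis. *)
Lemma pder_dilmul_cutoff1_cvg0 f s N (e : R) : isS f -> 0 < e ->
  \forall n \near \oo, forall x,
    (1 + `|x|) ^+ N * `|pder s (dilmul n.+1%:R^-1 cutoff1 f) x| <= e.
Proof.
elim/last_ind: s f e => [|s i IH] f e Sf e0; first exact: dilmul_cutoff1_cvg0.
have e2 : 0 < e / 2 by rewrite divr_gt0.
have H1 := IH _ _ (isS_dp i Sf) e2.
have H2 := dilmul_vanish s N (smooth_bounded_dp i cutoff_bounded) Sf e2.
near=> n => x.
have H3 : (1 + `|x|) ^+ N * `|pder s (dilmul n.+1%:R^-1 cutoff1 (dp i f)) x| <= e / 2.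
  by move: x; near: n; exact: H1.
have H4 : n.+1%:R^-1 * ((1 + `|x|) ^+ N * `|pder s (dilmul n.+1%:R^-1 (dp i cutoff) f) x|) <= e / 2.
  by move: x {H3}; near: n; exact: H2.
have Sb := @smooth_cutoff1.
rewrite pder_rcons (dp_dilmul _ _ Sb Sf.1) dp_cutoff1.
rewrite (pder_lin s n.+1%:R^-1 1 (smooth_dilmul n.+1%:R^-1 (smooth_dp i smooth_cutoff) Sf.1)
  (smooth_dilmul n.+1%:R^-1 Sb (smooth_dp i Sf.1))) mul1r.
rewrite [e]splitr; apply: le_trans (lerD H4 H3).
rewrite mulrCA -mulrDr; apply: ler_wpM2l; first exact: weight_ge0.
apply: (le_trans (ler_normD _ _)); apply: lerD => //.
by rewrite normrM ger0_norm.
Unshelve. all: by end_near. Qed.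

(** Upper bounds stand in for the Schwartz seminorm p_N, so no supremum has to be formed; the
    continuity clause of [is_Sprime] has the same shape. *)
Definition sn_le (N : nat) f (M : R) :=
  forall s x, (size s <= N)%N -> (1 + `|x|) ^+ N * `|pder s f x| <= M.

Definition localize (n : nat) f : fnc R d := dilmul n.+1%:R^-1 cutoff f.

Lemma localizeB n f : (fun x => localize n f x - f x) = dilmul n.+1%:R^-1 cutoff1 f.
Proof. by apply/funext => x; rewrite /localize /dilmul /cutoff1 mulrBl mul1r. Qed.

Lemma localize_cvg f N (e : R) : isS f -> 0 < e ->
  \forall n \near \oo, sn_le N (fun x => localize n f x - f x) e.
Proof.
move=> Sf e0.
(* Lists of length at most [N] over ['I_d] form a finite type, so the ranks obtained for each list
   combine into one. *)
have : \forall n \near \oo, forall s : N.-bseq 'I_d, forall x,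
    (1 + `|x|) ^+ N * `|pder s (dilmul n.+1%:R^-1 cutoff1 f) x| <= e.
  by apply: filter_forall => s; exact: pder_dilmul_cutoff1_cvg0.
apply: filterS => n H s x sN; rewrite localizeB; exact: (H (Bseq sN)).
Qed.

Lemma isD_localize n f : isS f -> isD (localize n f).
Proof.
move=> [sf _]; apply: (@in_ball_isD _ _ n.+1%:R).
  exact: smooth_dilmul smooth_cutoff sf.
move=> x /=; rewrite mulf_eq0 negb_or => /andP[/cutoff_supp /= + _].
by rewrite normrZ gtr0_norm ?invr_gt0 ?ltr0n// ler_pdivrMl ?ltr0n// mulr1.
Qed.

End Cutoff.

(** * A countable, sequentially dense family of test functions *)

Section Separability.
Set Implicit Arguments.
Unset Strict Implicit.
Context {R : realType} {d : nat}.
Local Notation pt := 'rV[R]_d.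
Implicit Types (f g : fnc R d) (x : pt) (s : seq 'I_d).

Lemma exists_invS_le (e : R) : 0 < e -> exists n : nat, n.+1%:R^-1 <= e.
Proof.
move=> e0; exists (Num.truncn e^-1); rewrite invf_ple ?posrE ?ltr0n//.
exact/ltW/truncnS_gt.
Qed.

Lemma in_ball_eq0 m f x s : in_ball m f -> m < `|x| -> pder s f x = 0.
Proof.
by move=> fm; apply: contraTeq => /(in_ball_pder fm) /=; rewrite -leNgt.
Qed.

(** Compactness gives a common modulus for points of the ball; otherwise either the other point lies
    in the ball, or both values vanish. *)
Lemma isD_unif_continuous f s (e : R) : isD f -> 0 < e ->
  \forall n \near \oo, forall x y, `|x - y| <= n.+1%:R^-1 ->
    `|pder s f x - pder s f y| <= e.
Proof.
move=> Df e0; have [m fm] := isD_in_ball Df.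
have e2 : 0 < e / 2 by rewrite divr_gt0.
have cK := @compact_ball R d m%:R.
pose P (n : nat) (x : pt) := forall y, `|x - y| <= n.+1%:R^-1 ->
  `|pder s f x - pder s f y| <= e.
have := (compact_near_coveringP [set x : pt | `|x| <= m%:R]).1 cK nat \oo P _.
move=> H; have : \forall n \near \oo, [set x : pt | `|x| <= m%:R] `<=` P n.
  apply: H => x _.
  have := (Df.1 s).1 x => /cvgrPdist_le /(_ _ e2) /nbhs_normP[del /= del0 Hd].
  have d2 : 0 < del / 2 by rewrite divr_gt0.
  have [n0 Hn0] := exists_invS_le d2.
  exists ([set y | `|x - y| < del / 2], [set n | (n0 <= n)%N]).
    split; last by exists n0.
    by have := nbhsx_ballx x _ d2; rewrite -ball_normE.
  move=> [y n] [/= xy n0n] z yz.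
  have zd : `|x - z| < del.
    rewrite -[x](subrK y) -addrA [del]splitr (le_lt_trans (ler_normD _ _))//.
    apply: ltr_leD => //; apply: (le_trans yz); apply: le_trans Hn0.
    by rewrite lef_pV2 ?posrE ?ltr0n// ler_nat ltnS.
  have yd : `|x - y| < del by rewrite (lt_trans xy)// gtr_pMr// invf_lt1 ?ltr1n.
  rewrite -[pder s f y](subrK (pder s f x)) -addrA [e]splitr.
  apply: (le_trans (ler_normD _ _)); apply: lerD; last exact: Hd.
  by rewrite distrC; exact: Hd.
apply: filterS => n Hn x y xy.
have [xm|xm] := leP `|x| m%:R; first exact: Hn.
have [ym|ym] := leP `|y| m%:R; first by rewrite distrC; apply: Hn => //; rewrite distrC.
by rewrite !(in_ball_eq0 _ fm)// subrr normr0 ltW.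
Qed.

(** Mesh 1/(k+1) on the cube [-m, m]^d, hence 2m(k+1) + 1 values per coordinate. Outside the cube
    the functions to be compared vanish. *)
Definition grid (m k : nat) (z : {ffun 'I_d -> 'I_(m.*2 * k.+1).+1}) : pt :=
  \row_i ((z i)%:R / k.+1%:R - m%:R).

Lemma grid_near m k x : `|x| <= m%:R ->
  exists z : {ffun 'I_d -> 'I_(m.*2 * k.+1).+1}, `|x - grid z| <= k.+1%:R^-1.
Proof.
move=> xm; have k0 : 0 < k.+1%:R :> R by rewrite ltr0n.
exists [ffun i => inord (Num.truncn ((x 0 i + m%:R) * k.+1%:R))].
apply: norm_le_coord => [|i]; first by rewrite invr_ge0 ltW.
have := le_trans (coord_le_norm x i) xm; rewrite ler_norml => /andP[x1 x2].
set t := (x 0 i + m%:R) * k.+1%:R.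
have t0 : 0 <= t by rewrite mulr_ge0 ?(ltW k0)// -lerBlDr sub0r.
have tm : t <= (m.*2 * k.+1)%:R.
  by rewrite natrM ler_pM2r// -addnn natrD lerD2r.
rewrite !mxE ffunE inordK; last first.
  rewrite ltnS -(ler_nat R) (le_trans _ tm)// truncn_le; exact: t0.
rewrite -/t; have -> : x 0 i - ((Num.truncn t)%:R / k.+1%:R - m%:R) = (t - (Num.truncn t)%:R) / k.+1%:R.
  by rewrite /t; field; rewrite gt_eqF.
rewrite normrM [X in _ * X]ger0_norm ?invr_ge0 ?(ltW k0)// ler_piMl ?invr_ge0 ?(ltW k0)//.
rewrite ger0_norm ?subr_ge0 ?truncn_le//.
by rewrite lerBlDl natr1 ltW// truncnS_gt.
Qed.

Definition dcode (m N j k : nat) f : seq int :=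
  [seq Num.floor (j.+1%:R * pder p.1 f (grid p.2))
     | p : N.-bseq 'I_d * {ffun 'I_d -> 'I_(m.*2 * k.+1).+1} <- enum {: N.-bseq 'I_d * {ffun 'I_d -> 'I_(m.*2 * k.+1).+1}}].

Definition dindex := (nat * nat * nat * nat * seq int)%type.

(* [j] is the precision of the values, [k] a modulus of uniform continuity for that precision. *)
Definition dclass (i : dindex) f : Prop :=
  let: (m, N, j, k, c) := i in
  [/\ isD f, in_ball m%:R f,
      forall s x y, (size s <= N)%N -> `|x - y| <= k.+1%:R^-1 ->
        `|pder s f x - pder s f y| <= j.+1%:R^-1 &
      dcode m N j k f = c].

Lemma floor_eq_dist (a b : R) : Num.floor a = Num.floor b -> `|a - b| <= 1.
Proof.
move=> ab; have := floor_le a; have := floorD1_gt a; have := floor_le b.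
have := floorD1_gt b; rewrite ab intrD; set c := (Num.floor b)%:~R.
by move=> h1 h2 h3 h4; rewrite ler_norml; apply/andP; split; lra.
Qed.

(** Three errors of 1/(j+1): from [x] to a grid point for [f], between the two functions at that
    point because their rounded values agree, and back to [x] for [g]. *)
Lemma dclass_close m N j k c f g s x : dclass (m, N, j, k, c) f ->
  dclass (m, N, j, k, c) g -> (size s <= N)%N ->
  `|pder s f x - pder s g x| <= 3 * j.+1%:R^-1.
Proof.
move=> [Df fm fu fc] [Dg gm gu gc] sN.
have j0 : 0 < j.+1%:R :> R by rewrite ltr0n.
have [xm|xm] := leP `|x| m%:R; last first.
  by rewrite !(in_ball_eq0 _ _ xm)// subrr normr0 mulr_ge0.
have [z xz] := grid_near k xm.
have E : Num.floor (j.+1%:R * pder s f (grid z)) = Num.floor (j.+1%:R * pder s g (grid z)).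
  have /eq_in_map H : dcode m N j k f = dcode m N j k g by rewrite fc gc.
  by apply: (H (Bseq sN, z)); rewrite mem_enum.
have := floor_eq_dist E; rewrite -mulrBr normrM gtr0_norm// -ler_pdivlMl// mulr1 => H.
have := fu s x (grid z) sN xz; have := gu s x (grid z) sN xz.
set A := pder s f x in H *; set B := pder s g x in H *; set a := pder s f _ in H *; set b := pder s g _ in H *.
move=> h1 h2.
have -> : A - B = (A - a) + (a - b) + (b - B) by ring.
apply: (le_trans (ler_normD _ _)).
have := ler_normD (A - a) (a - b); rewrite distrC in h1.
by move: h1 h2 H; set J := _^-1; lra.
Qed.

Lemma isD0 : isD (fun _ : pt => 0 : R).
Proof. by apply: (@in_ball_isD _ _ 0); [exact: smooth_cst|move=> x; rewrite eqxx]. Qed.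

(** Countability lies in the index: a code is a finite list of integers, and one function is chosen
    per inhabited class. The default 0 is again a test function. *)
Definition dseq (i : dindex) : fnc R d :=
  if pselect (exists f, dclass i f) is left H then projT1 (cid H) else (fun _ => 0).

Lemma dseq_class i f : dclass i f -> dclass i (dseq i).
Proof.
rewrite /dseq; case: pselect => [H _|H fi]; first exact: (projT2 (cid H)).
by exfalso; apply: H; exists f.
Qed.

Lemma isD_dseq i : isD (dseq i).
Proof.
rewrite /dseq; case: pselect => [H|_]; last exact: isD0.
by move: (projT2 (cid H)); case: i {H} (projT1 _) => [[[[m N] j] k] c] f [].
Qed.

Lemma dseq_dense m f N (e : R) : isD f -> in_ball m%:R f -> 0 < e ->
  exists i, in_ball m%:R (dseq i) /\
    forall s x, (size s <= N)%N -> `|pder s f x - pder s (dseq i) x| <= e.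
Proof.
move=> Df fm e0; have e3 : 0 < e / 3 by rewrite divr_gt0.
have [j je] := exists_invS_le e3.
have j0 : 0 < j.+1%:R^-1 :> R by rewrite invr_gt0 ltr0n.
have [k _ Hk] : \forall n \near \oo, forall s : N.-bseq 'I_d, forall x y, `|x - y| <= n.+1%:R^-1 ->
    `|pder s f x - pder s f y| <= j.+1%:R^-1.
  by apply: filter_forall => s; exact: isD_unif_continuous.
pose i := (m, N, j, k, dcode m N j k f) : dindex.
have fi : dclass i f.
  by split => // s x y sN; apply: (Hk k _ (Bseq sN)) => /=.
exists i; have gi := dseq_class fi.
split; first by case: gi.
move=> s x sN; apply: (le_trans (dclass_close x fi gi sN)).
by rewrite -ler_pdivlMl// mulrC.
Qed.

End Separability.

(** * Seminorm bounds and extension from D to S *)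

Section Extension.
Set Implicit Arguments.
Unset Strict Implicit.
Context {R : realType} {d : nat}.
Local Notation pt := 'rV[R]_d.
Implicit Types (f g : fnc R d) (x : pt) (s : seq 'I_d) (u v w : functional R d).

Lemma smooth_lin (a b : R) f g : smooth f -> smooth g -> smooth (fun x => a * f x + b * g x).
Proof. by move=> sf sg; exact: (smoothD (smoothZ a sf) (smoothZ b sg)). Qed.

Lemma sn_leD N (a b : R) f g (M1 M2 : R) : smooth f -> smooth g ->
  sn_le N f M1 -> sn_le N g M2 ->
  sn_le N (fun x => a * f x + b * g x) (`|a| * M1 + `|b| * M2).
Proof.
move=> sf sg H1 H2 s x sN; rewrite pder_lin//.
apply: (@le_trans _ _ ((1 + `|x|) ^+ N * (`|a| * `|pder s f x| + `|b| * `|pder s g x|))).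
  apply: ler_wpM2l; first exact: weight_ge0.
  by apply: (le_trans (ler_normD _ _)); rewrite !normrM.
rewrite mulrDr !(mulrCA ((1 + `|x|) ^+ N)).
by apply: lerD; apply: ler_wpM2l => //; [exact: H1|exact: H2].
Qed.

Lemma isS_lin (a b : R) f g : isS f -> isS g -> isS (fun x => a * f x + b * g x).
Proof.
move=> [sf Sf] [sg Sg]; split; first exact: smooth_lin.
move=> s n; have [C HC] := Sf s n; have [D HD] := Sg s n.
exists (`|a| * C + `|b| * D) => x; rewrite pder_lin//.
apply: (@le_trans _ _ ((1 + `|x|) ^+ n * (`|a| * `|pder s f x| + `|b| * `|pder s g x|))).
  apply: ler_wpM2l; first exact: weight_ge0.
  by apply: (le_trans (ler_normD _ _)); rewrite !normrM.
rewrite mulrDr !(mulrCA ((1 + `|x|) ^+ n)).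
by apply: lerD; apply: ler_wpM2l.
Qed.

Lemma in_ball_lin m (a b : R) f g : in_ball m f -> in_ball m g ->
  in_ball m (fun x => a * f x + b * g x).
Proof.
move=> fm gm x; have [->|/fm//] := eqVneq (f x) 0.
have [->|/gm//] := eqVneq (g x) 0.
by rewrite !mulr0 addr0 eqxx.
Qed.

Lemma in_ballW (m n : nat) f : (m <= n)%N -> in_ball m%:R f -> in_ball n%:R f.
Proof. by move=> mn fm x /fm /= /le_trans; apply; rewrite ler_nat. Qed.

Lemma isD_lin (a b : R) f g : isD f -> isD g -> isD (fun x => a * f x + b * g x).
Proof.
move=> Df Dg; have [m fm] := isD_in_ball Df; have [n gn] := isD_in_ball Dg.
apply: (@in_ball_isD _ _ (maxn m n)%:R); first exact: smooth_lin Df.1 Dg.1.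
by apply: in_ball_lin; [apply: in_ballW fm|apply: in_ballW gn];
  rewrite ?leq_maxl ?leq_maxr.
Qed.

Lemma sub_lin f g : (fun x => f x - g x) = (fun x => 1 * f x + (-1) * g x).
Proof. by apply/funext => x; rewrite mul1r mulN1r. Qed.

Lemma linear_onB (P : fnc R d -> Prop) u f g : linear_on P u -> P f -> P g ->
  u (fun x => f x - g x) = u f - u g.
Proof. by move=> lu Pf Pg; rewrite sub_lin lu// mul1r mulN1r. Qed.

Lemma isD_sub f g : isD f -> isD g -> isD (fun x => f x - g x).
Proof. by move=> Df Dg; rewrite sub_lin; exact: isD_lin. Qed.

Lemma isS_sub f g : isS f -> isS g -> isS (fun x => f x - g x).
Proof. by move=> Df Dg; rewrite sub_lin; exact: isS_lin. Qed.

Lemma sn_le_sub N f g (M1 M2 : R) : smooth f -> smooth g ->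
  sn_le N f M1 -> sn_le N g M2 -> sn_le N (fun x => f x - g x) (M1 + M2).
Proof.
move=> sf sg H1 H2; have := sn_leD 1 (-1) sf sg H1 H2.
by rewrite sub_lin normrN normr1 !mul1r.
Qed.

Lemma sn_le_ge0 N f (M : R) : sn_le N f M -> 0 <= M.
Proof. by move=> H; apply: le_trans (H [::] 0 _) => //; rewrite mulr_ge0// weight_ge0. Qed.

Lemma natr_divS_le (C : nat) (e : R) : 0 <= e -> C%:R * (e / C.+1%:R) <= e.
Proof.
move=> e0; rewrite mulrCA ler_piMr// ler_pdivrMr ?ltr0n// mul1r ler_nat.
exact: leqnSn.
Qed.

(** Natural numbers as constants make temperedness a countable union over [(C, N)]. *)
Definition sn_bounded (P : fnc R d -> Prop) (C N : nat) u :=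
  forall f, P f -> forall M : R, sn_le N f M -> `|u f| <= C%:R * M.

Lemma Sprime_sn_bounded u : is_Sprime u -> exists C N, sn_bounded (@isS R d) C N u.
Proof.
move=> [_ _ [C [N H]]]; exists (Num.truncn `|C|).+1, N => f Sf M HM.
apply: (le_trans (H f Sf M HM)); apply: ler_wpM2r; first exact: sn_le_ge0 HM.
by rewrite (le_trans (ler_norm C))// ltW// truncnS_gt.
Qed.

(** The domain [P] is a parameter because the argument serves twice: for tempered functionals on S,
    and for elements of D' whose bound is known only on D. *)
Lemma localize_fun_cvg (P : fnc R d -> Prop) u C N f :
  (forall g, isD g -> P g) -> (forall g h, P g -> P h -> P (fun x => g x - h x)) ->
  linear_on P u -> sn_bounded P C N u ->
  isS f -> P f -> u (localize n f) @[n --> \oo] --> u f.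
Proof.
move=> DP PB lu bu Sf Pf; apply/cvgrPdist_le => e e0.
have e1 : 0 < e / C.+1%:R by rewrite divr_gt0.
have := localize_cvg N Sf e1; apply: filterS => n Hn.
have Dc := DP _ (isD_localize n Sf).
rewrite distrC -(linear_onB lu Dc Pf).
apply: (le_trans (bu _ (PB _ _ Dc Pf) _ Hn)).
exact/natr_divS_le/ltW.
Qed.

Lemma localize_Sprime_cvg (w : Sprime R d) f : isS f ->
  proj1_sig w (localize n f) @[n --> \oo] --> proj1_sig w f.
Proof.
move=> Sf; have [_ lw _] := proj2_sig w.
have [C [N bw]] := Sprime_sn_bounded (proj2_sig w).
exact: (localize_fun_cvg (@isD_isS R d) isS_sub lw bw Sf Sf).
Qed.

(** The hypothesis controls [v] on the approximant, and continuity of [v] on a ball controls it on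
    the remainder [h]. Hence the need for [dseq_dense] to keep the radius [m] of the support. *)
Lemma dense_bounded v C N : is_Dprime v ->
  (forall i (M : R), sn_le N (dseq i : fnc R d) M -> `|v (dseq i)| <= C%:R * M) ->
  sn_bounded (@isD R d) C N v.
Proof.
move=> [_ lv cv] H f Df M HM; have [m fm] := isD_in_ball Df.
have [CK [NK HK]] := cv _ (@compact_ball R d m%:R).
apply/ler_addgt0Pr => e e0.
(* The coefficients of [del] in the final estimate: the Schwartz bound of [h], the continuity bound
   [CK], and 1 to make [D] positive. *)
pose D := C%:R * (1 + m%:R) ^+ N + `|CK| + 1.
have w0 : 0 <= (1 + m%:R) ^+ N :> R by rewrite exprn_ge0// addr_ge0.
have D0 : 0 < D by rewrite ltr_wpDl// addr_ge0// mulr_ge0.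
pose del := e / D.
have del0 : 0 < del by rewrite divr_gt0.
(* The order [maxn N NK] serves both the Schwartz seminorm and the continuity estimate on the
   ball. *)
have [i [gm Hi]] := dseq_dense (maxn N NK) Df fm del0.
have Dg := @isD_dseq R d i.
pose h := fun x => f x - dseq i x.
have Dh : isD h by exact: isD_sub.
have hm : in_ball m%:R h.
  by rewrite /h sub_lin; exact: in_ball_lin.
have hd s x : (size s <= maxn N NK)%N -> `|pder s h x| <= del.
  by move=> sN; rewrite pderB ?Df.1 ?Dg.1//; [exact: Hi|exact: Df.1|exact: Dg.1].
have hN : sn_le N h ((1 + m%:R) ^+ N * del).
  move=> s x sN; have [xm|xm] := leP `|x| m%:R; last first.
    by rewrite (in_ball_eq0 _ hm xm) normr0 mulr0 mulr_ge0// ltW.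
  apply: ler_pM => //.
    by rewrite lerXn2r ?nnegrE ?addr_ge0// lerD2l.
  by apply: hd; rewrite (leq_trans sN)// leq_maxl.
have gN : sn_le N (dseq i : fnc R d) (M + (1 + m%:R) ^+ N * del).
  have := sn_le_sub Df.1 Dh.1 HM hN; rewrite (_ : (fun x => f x - h x) = dseq i)//.
  by apply/funext => x; rewrite /h opprB addrC subrK.
have vh : `|v h| <= CK * del.
  by apply: HK => // s x sN; apply: hd; rewrite (leq_trans sN)// leq_maxr.
have -> : v f = v h + v (dseq i) by rewrite /h (linear_onB lv Df Dg) subrK.
apply: (le_trans (ler_normD _ _)).
have vg := H i _ gN.
have -> : e = D * del by rewrite /del mulrC divfK// gt_eqF.
apply: (le_trans (lerD vh vg)).
have : CK * del <= `|CK| * del by rewrite ler_wpM2r ?ler_norm// ltW.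
rewrite /D; move: (C%:R) ((1 + m%:R) ^+ N) (`|CK|) => c w k hk.
have -> : c * M + (c * w + k + 1) * del = k * del + c * (M + w * del) + del by ring.
by apply: (le_trans (lerD hk (lexx _))); rewrite lerDl ltW.
Qed.

Definition extension v : functional R d :=
  fun f => if `[< isS f >] then limn (fun n => v (localize n f)) else 0.

Lemma extension_cvg v C N f : linear_on (@isD R d) v -> sn_bounded (@isD R d) C N v ->
  isS f -> v (localize n f) @[n --> \oo] --> extension v f.
Proof.
move=> lv bv Sf; rewrite /extension; case: asboolP => // _.
apply: (@cauchy_cvg R); apply: cauchy_exP => e e0.
(* Two truncation errors of this size, multiplied by [C], add up to at most [e / 2], strictly below
   [e]; [C.+1] allows [C = 0]. *)
have e1 : 0 < e / 4 / C.+1%:R by rewrite !divr_gt0.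
have [n0 _ Hn0] := localize_cvg N Sf e1.
exists (v (localize n0 f)); exists n0 => // n n0n /=.
rewrite /ball /= distrC; have Dn := isD_localize n Sf; have Dm := isD_localize n0 Sf.
rewrite -(linear_onB lv Dn Dm).
have H := sn_le_sub (isS_sub (isD_isS Dn) Sf).1 (isS_sub (isD_isS Dm) Sf).1 (Hn0 n n0n) (Hn0 n0 (leqnn _)).
have := bv _ (isD_sub Dn Dm) (e / 4 / C.+1%:R + e / 4 / C.+1%:R).
have -> : (fun x => localize n f x - localize n0 f x) =
    (fun x => (localize n f x - f x) - (localize n0 f x - f x)).
  by apply/funext => x; ring.
move=> /(_ H) /le_lt_trans; apply.
have c1 : C%:R < C.+1%:R :> R by rewrite ltr_nat.
have c2 : 0 < C.+1%:R :> R by rewrite ltr0n.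
have -> : C%:R * (e / 4 / C.+1%:R + e / 4 / C.+1%:R) = C%:R / C.+1%:R * (e / 2) :> R by field; lra.
have : C%:R / C.+1%:R <= 1 :> R by rewrite ler_pdivrMr// mul1r ltW.
by move: (_ / _) => q q1; nra.
Qed.

(** Linearity and the bound, with the same [C] and [N], pass to the limit. On D the truncations
    converge in p_N, so the limit there is [v] itself. *)
Lemma extension_Sprime v C N : is_Dprime v -> sn_bounded (@isD R d) C N v ->
  is_Sprime (extension v) /\ v = restrictD (extension v).
Proof.
move=> [v0 lv _] bv.
have cv f : isS f -> v (localize n f) @[n --> \oo] --> extension v f.
  exact: extension_cvg lv bv.
split; last first.
  apply/funext => f; rewrite /restrictD; case: asboolP => Df; last exact: v0.
  apply: (cvg_unique _ _ (cv f (isD_isS Df))) => //.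
  exact: (localize_fun_cvg (fun _ h => h) isD_sub lv bv (isD_isS Df) Df).
split.
- by move=> f Sf; rewrite /extension; case: asboolP.
- move=> a b f g Sf Sg; apply: (cvg_unique _ (cv _ (isS_lin a b Sf Sg))) => //.
  have -> : (fun n => v (localize n (fun x => a * f x + b * g x))) =
      (fun n => a * v (localize n f) + b * v (localize n g)).
    apply/funext => n; rewrite -lv; [|exact: isD_localize..].
    by congr v; apply/funext => x; rewrite /localize /dilmul; ring.
  by apply: cvgD; apply: cvgM => //; [exact: cvg_cst|exact: cv|exact: cvg_cst|exact: cv].
exists C%:R, N => f Sf M HM; apply/ler_addgt0Pr => e e0.
have e1 : 0 < e / C.+1%:R by rewrite divr_gt0.
have Hc : `|v (localize n f)| @[n --> \oo] --> `|extension v f|.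
  exact: cvg_norm (cv f Sf).
apply: (cvgr_to_le Hc).
have := localize_cvg N Sf e1; apply: filterS => n Hn.
have Dn := isD_localize n Sf.
have : sn_le N (localize n f) (M + e / C.+1%:R).
  have -> : localize n f = (fun x => 1 * f x + 1 * (localize n f x - f x)).
    by apply/funext => x; ring.
  have := sn_leD 1 1 Sf.1 (isS_sub (isD_isS Dn) Sf).1 HM Hn.
  by rewrite normr1 !mul1r.
move=> /(bv _ Dn) /le_trans; apply; rewrite mulrDr lerD2l.
exact/natr_divS_le/ltW.
Qed.

End Extension.

(** * Borel sets of R^N and coordinatewise measurability *)

Section RowMeasurability.
Set Implicit Arguments.
Unset Strict Implicit.
Context {R : realType}.

Lemma countable_bigcapT_measurable disp (T : measurableType disp) (U : countType)
    (F : U -> set T) : (forall i, measurable (F i)) -> measurable (\bigcap_i F i).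
Proof.
move=> mF; rewrite -[X in measurable X]setCK setC_bigcap; apply: measurableC.
by apply: countable_bigcupT_measurable => // i; exact: measurableC.
Qed.

(** Second countability made explicit. Boxes not inside [O] are replaced by the empty set, so the
    countable index type does not depend on [O]. *)
Lemma open_box_cover N (O : set 'rV[R]_N) : open O ->
  let box (p : 'rV[rat]_N * nat) :=
    [set y : 'rV[R]_N | forall i, `|y 0 i - ratr (p.1 0 i)| < p.2.+1%:R^-1] in
  O = \bigcup_p (if `[< box p `<=` O >] then box p else set0).
Proof.
move=> oO box; apply/seteqP; split=> [y Oy|y [p _]]; last by case: asboolP => [H|_ []]; exact: H.
have : nbhs y O by exact: open_nbhs_nbhs.
move=> /nbhs_ballP[e /= e0 yO].
have e2 : 0 < e / 2 by rewrite divr_gt0.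
have [k ke] := exists_invS_le e2.
have k0 : 0 < k.+1%:R^-1 :> R by rewrite invr_gt0 ltr0n.
have Q i : {q : rat | `|y 0 i - ratr q| < k.+1%:R^-1}.
  apply: cid; move: k0 {ke}; move: (k.+1%:R^-1) => r r0.
  have : y 0 i - r < y 0 i + r by lra.
  move=> /rat_in_itvoo[q]; rewrite in_itv /= => /andP[q1 q2]; exists q.
  by rewrite ltr_norml; apply/andP; split; lra.
pose p := (\row_i (projT1 (Q i)), k) : 'rV[rat]_N * nat.
have py : box p y by move=> i; rewrite /= mxE; exact: (projT2 (Q i)).
exists p => //; case: asboolP => // H; exfalso; apply: H => z zp.
apply: yO; split => // i j; rewrite ord1.
have := py j; have := zp j; rewrite /ball /= => h1 h2.
rewrite -[y 0 j](subrK (ratr (p.1 0 j))) -addrA [e]splitr (le_lt_trans (ler_normD _ _))//.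
by rewrite ltrD// ?(lt_le_trans h2)// distrC (lt_le_trans h1).
Qed.

Lemma measurable_row disp (X : measurableType disp) N (h : 'I_N -> X -> R) :
  (forall i, measurable_fun setT (h i)) ->
  forall B : set 'rV[R]_N, borelRN B -> measurable [set x | B (\row_i h i x)].
Proof.
move=> mh; pose G := [set B : set 'rV[R]_N | measurable [set x | B (\row_i h i x)]].
suff : @borelRN R N `<=` G by exact.
apply: smallest_sub.
  split.
  - rewrite /G /= (_ : [set _ | _] = set0)//.
  - move=> A GA; rewrite /G /=.
    rewrite (_ : [set _ | _] = ~` [set x | A (\row_i h i x)]); first exact: measurableC.
    by apply/seteqP; split => [x []|x ?].
  - move=> A GA; rewrite /G /=.
    rewrite (_ : [set _ | _] = \bigcup_k [set x | A k (\row_i h i x)]).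
      by apply: bigcupT_measurable => k; exact: GA.
    by [].
move=> O /= oO; rewrite /G /=.
rewrite {1}(open_box_cover oO) /=.
set F := fun p : 'rV[rat]_N * nat => _.
rewrite (_ : [set _ | _] = \bigcup_p [set x | F p (\row_i h i x)]); last by [].
apply: countable_bigcupT_measurable => // p; rewrite /F.
case: asboolP => _ /=; last first.
  by rewrite (_ : [set _ | _] = set0).
rewrite (_ : [set _ | _] = \bigcap_i (h i @^-1` `]ratr (p.1 0 i) - p.2.+1%:R^-1, ratr (p.1 0 i) + p.2.+1%:R^-1[)).
  apply: countable_bigcapT_measurable => i; rewrite -[X in measurable X]setTI.
  exact: mh.
have E (a b r : R) : (`|a - b| < r) = (b - r < a < b + r).
  by rewrite ltr_norml; apply/andP/andP => -[h1 h2]; split; lra.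
apply/seteqP; split => x /= H i; have := H i.
  by rewrite mxE /= in_itv /= E.
by move=> /(_ I); rewrite mxE /= in_itv /= E.
Qed.

Lemma cylinders_gt d (P : fnc R d -> Prop) (T : Type) (ev_ : T -> functional R d)
    (phi : fnc R d) (c : R) :
  P phi -> cylinders P ev_ [set u | c < ev_ u phi].
Proof.
move=> Pphi; exists 1%N, (fun=> phi), [set y | c < y 0 0]; split => //.
  apply: sub_sigma_algebra => /=.
  apply: (@open_comp _ _ (fun y : 'rV[R]_1 => y 0 0) [set z | c < z]).
    by move=> y _; exact: coord_continuous.
  exact: open_gt.
by apply/seteqP; split => u /=; rewrite mxE.
Qed.

Lemma measurable_fun_gt disp (X : measurableType disp) (h : X -> R) :
  (forall c, measurable [set x | c < h x]) -> measurable_fun setT h.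
Proof.
move=> H; apply: (measurability _ (RGenOInfty.measurableE R)) => _ [_ [c ->] <-].
rewrite setTI (_ : _ @^-1` _ = [set x | c < h x])//.
by apply/seteqP; split => x /=; rewrite in_itv /= andbT.
Qed.

End RowMeasurability.

(** * Measurability of the image of S' and of the inverse of restriction *)

Section TemperedMeasurability.
Set Implicit Arguments.
Unset Strict Implicit.
Context {R : realType} {d : nat}.
Implicit Types (f phi : fnc R d).

Lemma measurable_evalD phi : isD phi ->
  measurable_fun setT (fun u : DprimeM R d => proj1_sig u phi).
Proof.
move=> Dphi; apply: measurable_fun_gt => c; apply: sub_sigma_algebra.
exact: (cylinders_gt (@proj1_sig _ _) c Dphi).
Qed.

Lemma measurable_evalS phi : isS phi ->
  measurable_fun setT (fun u : SprimeM R d => proj1_sig u phi).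
Proof.
move=> Sphi; apply: measurable_fun_gt => c; apply: sub_sigma_algebra.
exact: (cylinders_gt (@proj1_sig _ _) c Sphi).
Qed.

Lemma restrictD_sn_bounded (w : Sprime R d) C N :
  sn_bounded (@isS R d) C N (proj1_sig w) ->
  sn_bounded (@isD R d) C N (restrictD (proj1_sig w)).
Proof.
move=> bw f Df M HM; rewrite /restrictD asboolT//; apply: (bw _ _ _ HM).
exact: isD_isS.
Qed.

(** On a compact set the polynomial weight is bounded, so a Schwartz bound yields the local bound
    required in D'. *)
Lemma restrictD_Dprime (w : Sprime R d) : is_Dprime (restrictD (proj1_sig w)).
Proof.
have [_ lw _] := proj2_sig w; have [C [N bw]] := Sprime_sn_bounded (proj2_sig w).
split.
- by move=> f nDf; rewrite /restrictD asboolF.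
- move=> a b f g Df Dg; rewrite /restrictD !asboolT//; last exact: isD_lin.
  by rewrite lw//; exact: isD_isS.
- move=> K cK; have [B [Br KB]] := compact_bounded cK.
  exists (C%:R * (1 + (`|B| + 1)) ^+ N), N => f Df Kf M HM.
  have W0 : 0 <= 1 + (`|B| + 1) by rewrite !addr_ge0.
  rewrite -mulrA; apply: (restrictD_sn_bounded bw Df) => s x sN.
  have [->|] := eqVneq (pder s f x) 0.
    rewrite normr0 mulr0 mulr_ge0 ?exprn_ge0//.
    by apply: le_trans (HM [::] 0 _).
  have fB : in_ball (`|B| + 1) f.
    move=> y /Kf Ky /=; apply: (KB (`|B| + 1)) => //.
    by rewrite (le_lt_trans (ler_norm B))// ltrDl.
  move=> /(in_ball_pder fB) /= xB; apply: ler_pM => //; last exact: HM.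
  by rewrite lerXn2r ?nnegrE ?addr_ge0// lerD2l.
Qed.

Definition restriction (w : SprimeM R d) : DprimeM R d :=
  exist _ (restrictD (proj1_sig w)) (restrictD_Dprime w).

Lemma measurable_restriction : measurable_fun setT restriction.
Proof.
apply: (@measurability _ _ (SprimeM R d) (DprimeM R d) setT restriction (@cylD R d) erefl) => _ [_ [N [phi [B [Dphi bB ->]]]] <-].
rewrite setTI.
rewrite (_ : _ @^-1` _ = [set w : SprimeM R d | B (\row_i proj1_sig w (phi i))]).
  by apply: measurable_row => // i; exact: (measurable_evalS (isD_isS (Dphi i))).
have E (w : SprimeM R d) :
    \row_i proj1_sig (restriction w) (phi i) = \row_i proj1_sig w (phi i).
  by apply/rowP => i; rewrite !mxE /= /restrictD asboolT.
by apply/seteqP; split => w; rewrite /= E.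
Qed.

Lemma restrictD_inj (w1 w2 : Sprime R d) :
  restrictD (proj1_sig w1) = restrictD (proj1_sig w2) -> w1 = w2.
Proof.
move=> E; apply: eq_sig_hprop => [u p q|]; first exact: Prop_irrelevance.
apply/funext => f; rewrite -/(proj1_sig w1) -/(proj1_sig w2).
have [Sf|nSf] := pselect (isS f); last first.
  by have [z1 _ _] := proj2_sig w1; have [z2 _ _] := proj2_sig w2; rewrite z1// z2.
have L1 := @localize_Sprime_cvg _ _ w1 f Sf.
have L2 := @localize_Sprime_cvg _ _ w2 f Sf.
have EL : (fun n => proj1_sig w1 (localize n f)) = (fun n => proj1_sig w2 (localize n f)).
  apply/funext => n; have := congr1 (fun u => u (localize n f)) E.
  by rewrite /restrictD asboolT//; exact: isD_localize.
rewrite EL in L1.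
by have := cvg_unique _ L1 L2; apply.
Qed.

Lemma embed_imageTE : embed_image [set: SprimeM R d] =
  \bigcup_(p : nat * nat) \bigcap_i
    [set v : DprimeM R d | forall M : R, sn_le p.2 (dseq i : fnc R d) M ->
       `|proj1_sig v (dseq i)| <= p.1%:R * M].
Proof.
apply/seteqP; split => v.
  move=> [w _ vw]; have [C [N bw]] := Sprime_sn_bounded (proj2_sig w).
  exists (C, N) => // i _ M HM /=; rewrite vw.
  exact: (restrictD_sn_bounded bw (isD_dseq i)).
move=> [[C N] _ H].
have bv : sn_bounded (@isD R d) C N (proj1_sig v).
  by apply: (dense_bounded (proj2_sig v)) => i M HM; exact: (H i I M HM).
have [Sw vw] := extension_Sprime (proj2_sig v) bv.
by exists (exist _ _ Sw).
Qed.

Lemma measurable_embed_imageT : measurable (embed_image [set: SprimeM R d]).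
Proof.
rewrite embed_imageTE; apply: countable_bigcupT_measurable => // -[C N].
apply: countable_bigcapT_measurable => i /=.
have mi := measurable_evalD (isD_dseq i).
(* Although [M] ranges over all reals, the admissible [y] form a downward closed subset of R, which
   is an interval and hence Borel. *)
set I := [set y : R | forall M : R, sn_le N (dseq i : fnc R d) M -> y <= C%:R * M].
rewrite (_ : [set _ | _] = (fun v : DprimeM R d => `|proj1_sig v (dseq i)|) @^-1` I)//.
rewrite -[X in measurable X]setTI.
apply: (measurableT_comp (@normr_measurable R setT) mi) => //.
apply: is_interval_measurable => x y _ Iy z /andP[_ zy] M HM.
by apply: (le_trans zy); exact: Iy.
Qed.

Definition tempered_ext (v : DprimeM R d) : SprimeM R d :=
  if pselect (exists w : Sprime R d, proj1_sig v = restrictD (proj1_sig w)) is left H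
  then projT1 (cid H) else exist _ _ (is_Sprime0 R d).

Lemma tempered_extE v (w : Sprime R d) :
  proj1_sig v = restrictD (proj1_sig w) -> tempered_ext v = w.
Proof.
move=> vw; rewrite /tempered_ext; case: pselect => [H|H]; last by exfalso; apply: H; exists w.
by apply: restrictD_inj; rewrite -(projT2 (cid H)).
Qed.

Lemma measurable_tempered_ext : measurable_fun setT tempered_ext.
Proof.
apply: (@measurability _ _ (DprimeM R d) (SprimeM R d) setT tempered_ext (@cylS R d) erefl) => _ [_ [N [phi [B [Sphi bB ->]]]] <-].
rewrite setTI.
rewrite (_ : _ @^-1` _ = [set v | B (\row_i proj1_sig (tempered_ext v) (phi i))])//.
apply: measurable_row => // i.
(* The indicator kills the sequence off the image, where the pairings with truncations may diverge
   and [tempered_ext] is 0. *)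
pose h n (v : DprimeM R d) : R :=
  \1_(embed_image [set: SprimeM R d]) v * proj1_sig v (localize n (phi i)).
apply: (@measurable_fun_cvg _ _ _ _ h) => [n|v _].
  apply: measurable_funM; first exact: measurable_indic measurable_embed_imageT.
  exact: (measurable_evalD (isD_localize n (Sphi i))).
rewrite /h indicE; have [|] := boolP (v \in _).
  rewrite inE => -[w _ vw]; rewrite (tempered_extE vw).
  rewrite (_ : (fun n => _) = (fun n => proj1_sig w (localize n (phi i)))).
    exact: localize_Sprime_cvg.
  by apply/funext => n; rewrite mul1r vw /restrictD asboolT//; exact: isD_localize.
rewrite notin_setE => nv; rewrite /tempered_ext; case: pselect => [[w vw]|_] /=.
  by exfalso; apply: nv; exists w.
rewrite (_ : (fun n => _) = cst 0); first exact: cvg_cst.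
by apply/funext => n; rewrite mul0r.
Qed.

(** Rewrites a direct image as a preimage under the inverse map, so only the full image has to be
    measured by hand. *)
Lemma embed_imageE (A : set (SprimeM R d)) :
  embed_image A = embed_image [set: SprimeM R d] `&` tempered_ext @^-1` A.
Proof.
apply/seteqP; split => v.
  by move=> [w Aw vw]; split; [exists w|rewrite /= (tempered_extE vw)].
by move=> [[w _ vw]]; rewrite /= (tempered_extE vw) => Aw; exists w.
Qed.

Lemma measurable_embed_image (A : set (SprimeM R d)) :
  measurable A -> measurable (embed_image A).
Proof.
move=> mA; rewrite embed_imageE; apply: measurableI; first exact: measurable_embed_imageT.
by rewrite -[X in measurable X]setTI; exact: measurable_tempered_ext.
Qed.

Lemma restriction_embed (A : set (SprimeM R d)) :
  restriction @^-1` (embed_image A) = A.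
Proof.
apply/seteqP; split => w /=; last by move=> Aw; exists w.
by move=> [w' Aw' /restrictD_inj ->].
Qed.

End TemperedMeasurability.

(** * Polynomials converging to the indicator of the positive axis *)

Section Threshold.
Set Implicit Arguments.
Unset Strict Implicit.
Context {R : realType}.

Lemma bernoulli_ge (a : R) n : -1 <= a -> 1 + a *+ n <= (1 + a) ^+ n.
Proof.
move=> a1; elim: n => [|n IH]; first by rewrite mulr0n addr0 expr0.
have a0 : 0 <= 1 + a by lra.
rewrite exprS; apply: (le_trans _ (ler_wpM2l a0 IH)).
have : 0 <= a * a * n%:R by rewrite mulr_ge0// -expr2 sqr_ge0.
rewrite mulrS -(mulr_natr a n) => h.
rewrite -subr_ge0 (_ : _ - _ = a * a * n%:R)//; ring.
Qed.

(** With [r = t * t], one factor [t ^+ n] absorbs [n] by Bernoulli's inequality for 1/t = 1 + h, and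
    the other tends to 0. *)
Lemma cvg_natr_geo (r : R) : 0 <= r -> r < 1 -> n%:R * r ^+ n @[n --> \oo] --> 0.
Proof.
move=> r0 r1; have [->|rn0] := eqVneq r 0.
  apply: (@cvg_trans _ ((fun _ : nat => 0 : R) @ \oo)); last exact: cvg_cst.
  by apply: near_eq_cvg; exists 1%N => // -[|n] _ //=; rewrite exprS mul0r mulr0.
pose t := Num.sqrt r.
have t0 : 0 < t by rewrite sqrtr_gt0 lt_neqAle eq_sym rn0.
have t1 : t < 1 by rewrite -sqrtr1 ltr_sqrt.
have rE : r = t * t by rewrite -expr2 sqr_sqrtr.
pose h := t^-1 - 1.
have h0 : 0 < h by rewrite subr_gt0 invf_gt1.
have B n : n%:R * t ^+ n <= h^-1.
  rewrite -ler_pdivlMr ?exprn_gt0// -exprVn mulrC -ler_pdivrMr ?invr_gt0// invrK.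
  have := @bernoulli_ge h n _; rewrite /h addrCA subrr addr0 => H.
  have : 1 + h *+ n <= t^-1 ^+ n by apply: H; rewrite -/h; lra.
  by apply: le_trans; rewrite mulr_natl lerDr.
apply/cvgr0Pnorm_le => e e0.
have eh : 0 < e * h by rewrite mulr_gt0.
have : t ^+ n @[n --> \oo] --> 0 by apply: cvg_expr; rewrite ger0_norm ?ltW.
move=> /cvgr0Pnorm_le /(_ _ eh); apply: filterS => n.
rewrite !ger0_norm ?mulr_ge0 ?exprn_ge0 ?(ltW t0)// => H.
rewrite rE exprMn mulrA (@le_trans _ _ (h^-1 * (e * h)))//.
  by apply: ler_pM; rewrite ?mulr_ge0 ?exprn_ge0 ?(ltW t0).
by rewrite mulrCA mulVf ?mulr1// gt_eqF.
Qed.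

(* With [q = (1 - s) / 2], the exponent makes [n 2^n q^n] tend to 0 for [q < 1/2] and to infinity
   for [q >= 1/2]. *)
Definition threshold (n : nat) (s : R) : R := (1 - ((1 - s) / 2) ^+ n) ^+ (n * 2 ^ n).

Lemma threshold_itv n s : -1 <= s <= 1 -> 0 <= threshold n s <= 1.
Proof.
move=> /andP[s1 s2]; have q0 : 0 <= (1 - s) / 2 by lra.
have q1 : (1 - s) / 2 <= 1 by lra.
have p1 : ((1 - s) / 2) ^+ n <= 1 by rewrite exprn_ile1.
have p0 : 0 <= ((1 - s) / 2) ^+ n by rewrite exprn_ge0.
rewrite /threshold exprn_ge0 ?subr_ge0//= exprn_ile1// ?subr_ge0//.
by rewrite lerBlDl lerDr.
Qed.

(** For [s > 0] Bernoulli's inequality gives the lower bound 1 - n(2q)^n; for [s <= 0], 1 - y <=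
    exp(-y) gives the upper bound exp(-n). The factor [n] in the exponent settles [s = 0], where (1
    - 2^-n)^(2^n) alone would tend to exp(-1). Similar polynomials occur in elementary proofs of the
    Stone-Weierstrass theorem. *)
Lemma threshold_cvg (s : R) : -1 <= s <= 1 ->
  threshold n s @[n --> \oo] --> (((0 < s)%R)%:R : R).
Proof.
move=> s11; have /andP[s1 s2] := s11.
set q := (1 - s) / 2; have q0 : 0 <= q by rewrite /q; lra.
have q1 : q <= 1 by rewrite /q; lra.
have pn1 n : q ^+ n <= 1 by rewrite exprn_ile1.
have [s0|s0] := ltP 0 s.
  have r0 : 0 <= 2 * q by rewrite mulr_ge0.
  have r1 : 2 * q < 1 by rewrite /q; lra.
  have L : 1 - n%:R * (2 * q) ^+ n @[n --> \oo] --> (1 : R).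
    by rewrite -[X in _ --> X]subr0; apply: cvgB; [exact: cvg_cst|exact: cvg_natr_geo].
  rewrite (_ : true%:R = 1 :> R)//.
  apply: (squeeze_cvgr _ L (cvg_cst (1 : R))); near=> n.
  have /andP[_ ->] := threshold_itv n s11; rewrite andbT.
  have := @bernoulli_ge (- q ^+ n) (n * 2 ^ n) _; rewrite lerN2 => /(_ (pn1 n)).
  rewrite mulNrn -[q ^+ n *+ _]mulr_natl natrM natrX -mulrA -exprMn => H; exact: H.
have qh : 1 <= 2 * q by rewrite /q; lra.
rewrite (_ : false%:R = 0 :> R)//.
apply: (squeeze_cvgr _ (cvg_cst (0 : R)) (@cvgn_expR R)); near=> n.
have /andP[-> _] := threshold_itv n s11; rewrite /=.
have : 1 - q ^+ n <= expR (- q ^+ n) by exact: expR_ge1Dx.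
move=> H; apply: (@le_trans _ _ (expR (- q ^+ n) ^+ (n * 2 ^ n))).
  by rewrite /threshold lerXn2r ?nnegrE ?expR_ge0// subr_ge0.
rewrite -expRM_natl ler_expR natrM natrX mulrN lerN2 -mulrA -exprMn.
by rewrite ler_peMr// exprn_ege1.
Unshelve. all: by end_near. Qed.

(** For large [n] the argument lies in (-2, 2), where the sine has the sign of [t]. This recovers
    half-lines from periodic sets. *)
Lemma sin_gt0_eventually (t : R) :
  0 < t <-> \forall n \near \oo, 0 < sin (n.+1%:R^-1 * t).
Proof.
have small (u : R) : 0 < u -> \forall n \near \oo, 0 < sin (n.+1%:R^-1 * u).
  move=> u0; exists (Num.truncn u) => // n /= un.
  apply: sin2_gt0; rewrite mulr_gt0 ?invr_gt0 ?ltr0n//=.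
  apply: (@lt_trans _ _ 1); last by rewrite ltr1n.
  rewrite mulrC ltr_pdivrMr ?ltr0n// mul1r.
  by apply: (lt_le_trans (truncnS_gt u)); rewrite ler_nat ltnS.
split; first exact: small.
move=> H; rewrite ltNge; apply/negP => t0.
have [t00|tn0] := eqVneq t 0.
  by case: H => n _ /(_ n (leqnn n)); rewrite /= t00 mulr0 sin0 ltxx.
have nt : 0 < - t by rewrite oppr_gt0 lt_neqAle tn0.
near \oo => n.
have h1 : 0 < sin (n.+1%:R^-1 * t) by near: n; exact: H.
have h2 : 0 < sin (n.+1%:R^-1 * - t) by near: n; exact: small.
by move: h2; rewrite mulrN sinN oppr_gt0 ltNge (ltW h1).
Unshelve. all: by end_near. Qed.

End Threshold.

(** * Probabilities with equal trigonometric integrals *)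

Section CharacteristicFunctional.
Set Implicit Arguments.
Unset Strict Implicit.
Context {R : realType} {disp : measure_display} {X : measurableType disp}.
Implicit Types (f g h : X -> R) (mu : probability X R).

Lemma bounded_integrable mu g (M : R) : measurable_fun setT g ->
  (forall x, `|g x| <= M) -> mu.-integrable setT (EFin \o g).
Proof.
move=> mg gM; apply: measurable_bounded_integrable => //.
  by rewrite (le_lt_trans (probability_le1 _ _))// ltry.
exists M; split; first exact: num_real.
by move=> K MK x _ /=; apply: (le_trans (gM x)); exact: ltW.
Qed.

(** The phase [c] lets one constructor yield cosines, sines and, from the zero function,
    constants. *)
Inductive trig (F : set (X -> R)) : (X -> R) -> Prop :=
| trig_cos f (c : R) : F f -> trig F (fun x => cos (f x + c))
| trig_lin (a b : R) g h : trig F g -> trig F h ->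
    trig F (fun x => a * g x + b * h x).

Lemma measurable_cos_shift f (c : R) : measurable_fun setT f ->
  measurable_fun setT (fun x => cos (f x + c)).
Proof.
move=> mf; apply: (measurableT_comp (f := cos)).
  by apply: continuous_measurable_fun; exact: continuous_cos.
by apply: measurable_funD => //; exact: measurable_cst.
Qed.

Variables (P Q : probability X R) (F : set (X -> R)).
Hypotheses (F0 : F (fun=> 0))
  (Flin : forall (a b : R) f g, F f -> F g -> F (fun x => a * f x + b * g x))
  (Fm : forall f, F f -> measurable_fun setT f)
  (Ecos : forall f, F f -> (\int[P]_x (cos (f x))%:E = \int[Q]_x (cos (f x))%:E)%E)
  (Esin : forall f, F f -> (\int[P]_x (sin (f x))%:E = \int[Q]_x (sin (f x))%:E)%E).

Lemma trig_measurable g : trig F g -> measurable_fun setT g.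
Proof.
elim=> {g} [f c Ff|a b g h _ mg _ mh]; first exact/measurable_cos_shift/Fm.
by apply: measurable_funD; apply: measurable_funM => //; exact: measurable_cst.
Qed.

Lemma cos_norm_le1 (t : R) : `|cos t| <= 1.
Proof. by rewrite ler_norml cos_geN1 cos_le1. Qed.

Lemma sin_norm_le1 (t : R) : `|sin t| <= 1.
Proof. by rewrite ler_norml sin_geN1 sin_le1. Qed.

Lemma trig_bounded g : trig F g -> exists M : R, forall x, `|g x| <= M.
Proof.
elim=> {g} [f c Ff|a b g h _ [M HM] _ [N HN]].
  by exists 1 => x; exact: cos_norm_le1.
exists (`|a| * M + `|b| * N) => x; rewrite (le_trans (ler_normD _ _))// !normrM.
by apply: lerD; apply: ler_wpM2l.
Qed.

Lemma integral_lin mu (a b : R) g h :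
  mu.-integrable setT (EFin \o g) -> mu.-integrable setT (EFin \o h) ->
  (\int[mu]_x (a * g x + b * h x)%:E =
   a%:E * \int[mu]_x (g x)%:E + b%:E * \int[mu]_x (h x)%:E)%E.
Proof.
move=> ig ih.
under eq_integral do rewrite EFinD !EFinM.
rewrite integralD//; [|exact: integrableZl..].
by rewrite !integralZl.
Qed.

Lemma trig_integral g : trig F g -> (\int[P]_x (g x)%:E = \int[Q]_x (g x)%:E)%E.
Proof.
elim=> {g} [f c Ff|a b g h tg Eg th Eh].
  have mc : measurable_fun setT (fun x => cos (f x)).
    have := measurable_cos_shift 0 (Fm Ff).
    by under eq_fun do rewrite addr0.
  have ms : measurable_fun setT (fun x => sin (f x)).
    have := measurable_cos_shift (- (pi / 2)) (Fm Ff).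
    by under eq_fun do rewrite cosBpihalf.
  have E x : (cos (f x + c))%:E = (cos c * cos (f x) + (- sin c) * sin (f x))%:E.
    by congr EFin; rewrite cosD mulNr [cos c * _]mulrC [sin c * _]mulrC.
  under eq_integral do rewrite E.
  under [RHS]eq_integral do rewrite E.
  have ic mu : mu.-integrable setT (EFin \o (fun x => cos (f x))).
    by apply: (bounded_integrable mu mc) => x; exact: cos_norm_le1.
  have js mu : mu.-integrable setT (EFin \o (fun x => sin (f x))).
    by apply: (bounded_integrable mu ms) => x; exact: sin_norm_le1.
  by rewrite (integral_lin _ _ (ic P) (js P)) (integral_lin _ _ (ic Q) (js Q)) Ecos// Esin.
have [M HM] := trig_bounded tg; have [N HN] := trig_bounded th.
have ig mu := bounded_integrable mu (trig_measurable tg) HM.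
have ih mu := bounded_integrable mu (trig_measurable th) HN.
by rewrite (integral_lin _ _ (ig P) (ih P)) (integral_lin _ _ (ig Q) (ih Q)) Eg Eh.
Qed.

Lemma trig_cst (c : R) : trig F (fun=> c).
Proof.
rewrite (_ : (fun=> c) = (fun x => c * cos (0 + 0) + 0 * cos (0 + 0))).
  by apply: (trig_lin c 0 (g := fun=> cos (0 + 0)) (h := fun=> cos (0 + 0)));
    exact: (trig_cos 0 F0).
by apply/funext => x; rewrite addr0 cos0 mul0r addr0 mulr1.
Qed.

(** Product-to-sum formulas: closure of [F] under sums and differences returns each product of
    cosines to the span. *)
Lemma trig_mul g h : trig F g -> trig F h -> trig F (fun x => g x * h x).
Proof.
move=> tg th; elim: tg => {g} [f c Ff|a b g1 g2 _ IH1 _ IH2].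
  elim: th => {h} [f' c' Ff'|a b h1 h2 _ IH1 _ IH2].
    rewrite (_ : (fun x => _) = (fun x =>
        2^-1 * cos ((1 * f x + 1 * f' x) + (c + c')) +
        2^-1 * cos ((1 * f x + -1 * f' x) + (c - c')))).
      apply: (trig_lin 2^-1 2^-1 (g := fun x => cos ((1 * f x + 1 * f' x) + (c + c')))
        (h := fun x => cos ((1 * f x + -1 * f' x) + (c - c')))).
        exact: (trig_cos (c + c') (Flin 1 1 Ff Ff')).
      exact: (trig_cos (c - c') (Flin 1 (-1) Ff Ff')).
    apply/funext => x.
    have -> : 1 * f x + 1 * f' x + (c + c') = (f x + c) + (f' x + c') by ring.
    have -> : 1 * f x + -1 * f' x + (c - c') = (f x + c) - (f' x + c') by ring.
    move: (f x + c) (f' x + c') => A B.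
    by rewrite cosD cosB; field.
  rewrite (_ : (fun x => _) = (fun x => a * (cos (f x + c) * h1 x) + b * (cos (f x + c) * h2 x))).
    exact: (trig_lin a b IH1 IH2).
  by apply/funext => x; ring.
rewrite (_ : (fun x => _) = (fun x => a * (g1 x * h x) + b * (g2 x * h x))).
  exact: (trig_lin a b IH1 IH2).
by apply/funext => x; ring.
Qed.

Lemma trig_exp g n : trig F g -> trig F (fun x => g x ^+ n).
Proof.
move=> tg; elim: n => [|n IH]; first exact: trig_cst.
rewrite (_ : (fun x => _) = (fun x => g x * g x ^+ n)); first exact: trig_mul.
by apply/funext => x; rewrite exprS.
Qed.

Lemma trig_onem g (a : R) : trig F g -> trig F (fun x => a - a * g x).
Proof.
move=> tg; rewrite (_ : (fun x => _) = (fun x => 1 * a + (- a) * g x)).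
  exact: (trig_lin 1 (- a) (trig_cst a) tg).
by apply/funext => x; rewrite mul1r mulNr.
Qed.

Lemma trig_threshold g n : trig F g -> trig F (fun x => threshold n (g x)).
Proof.
move=> tg; have t1 := trig_exp n (trig_onem 2^-1 tg).
have := trig_exp (n * 2 ^ n) (trig_onem 1 t1).
rewrite (_ : (fun x => (1 - 1 * (2^-1 - 2^-1 * g x) ^+ n) ^+ (n * 2 ^ n)) =
  (fun x => threshold n (g x)))//.
apply/funext => x; rewrite /threshold mul1r; congr ((1 - _ ^+ _) ^+ _); by field.
Qed.

Lemma trig_sin f (c : R) : F f -> trig F (fun x => sin (f x - c)).
Proof.
move=> Ff; rewrite (_ : (fun x => _) = (fun x => cos (f x + (- c - pi / 2)))).
  exact: trig_cos.
by apply/funext => x; rewrite addrA cosBpihalf.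
Qed.

Definition sin_pos (p : (X -> R) * R) : set X := [set x | 0 < sin (p.1 x - p.2)].

Definition sin_pos_pi : set (set X) :=
  [set A | exists s : seq ((X -> R) * R), (forall p, List.In p s -> F p.1) /\
    A = [set x | forall p, List.In p s -> sin_pos p x]].

Definition threshold_prod n (s : seq ((X -> R) * R)) (x : X) : R :=
  \prod_(p <- s) threshold n (sin (p.1 x - p.2)).

Lemma trig_threshold_prod n s : (forall p, List.In p s -> F p.1) ->
  trig F (threshold_prod n s).
Proof.
elim: s => [|p s IH] Fs.
  rewrite (_ : threshold_prod n [::] = fun=> 1); first exact: trig_cst.
  by apply/funext => x; rewrite /threshold_prod big_nil.
rewrite (_ : threshold_prod n (p :: s) =
  fun x => threshold n (sin (p.1 x - p.2)) * threshold_prod n s x).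
  apply: trig_mul; first by apply/trig_threshold/trig_sin/Fs; left.
  by apply: IH => q qs; apply: Fs; right.
by apply/funext => x; rewrite /threshold_prod big_cons.
Qed.

Lemma threshold_prod_itv n s x : 0 <= threshold_prod n s x <= 1.
Proof.
rewrite /threshold_prod; elim/big_ind: _ => [|a b /andP[a0 a1] /andP[b0 b1]|p _].
- by rewrite ler01 lexx.
- by rewrite mulr_ge0//= mulr_ile1.
- by apply: threshold_itv; rewrite sin_geN1 sin_le1.
Qed.

Lemma threshold_prod_cvg s x : threshold_prod n s x @[n --> \oo] -->
  (\1_[set x | forall p, List.In p s -> sin_pos p x] x : R).
Proof.
elim: s => [|p s IH].
  rewrite indicE mem_set//.
  rewrite (_ : (fun n => _) = (fun=> 1)); first exact: cvg_cst.
  by apply/funext => n; rewrite /threshold_prod big_nil.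
rewrite (_ : (fun n => _) = (fun n => threshold n (sin (p.1 x - p.2)) * threshold_prod n s x)); last first.
  by apply/funext => n; rewrite /threshold_prod big_cons.
have H : -1 <= sin (p.1 x - p.2) <= 1 by rewrite sin_geN1 sin_le1.
rewrite (_ : \1_ _ x = ((0 < sin (p.1 x - p.2))%R)%:R * \1_[set x | forall p, List.In p s -> sin_pos p x] x :> R).
  by apply: cvgM => //; exact: threshold_cvg.
rewrite !indicE -natrM mulnb; congr (_%:R : R); congr nat_of_bool.
apply/idP/andP.
  rewrite inE /= => A; split; first by apply: (A p); left.
  by rewrite inE => q qs; apply: A; right.
by rewrite !inE => -[A B] q [<-//|qs]; exact: B.
Qed.

Lemma sin_pos_measurable p : F p.1 -> measurable (sin_pos p).
Proof.
move=> Fp; have mp := trig_measurable (trig_sin p.2 Fp).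
rewrite (_ : sin_pos p = (fun x => sin (p.1 x - p.2)) @^-1` `]0, +oo[).
  by rewrite -[X in measurable X]setTI; exact: mp.
by apply/seteqP; split => x; rewrite /sin_pos /= in_itv /= andbT.
Qed.

Lemma sin_pos_pi_measurable A : sin_pos_pi A -> measurable A.
Proof.
move=> [s [Fs ->]]; elim: s Fs => [|p s IH] Fs.
  by rewrite (_ : [set _ | _] = setT)//; apply/seteqP; split => // x _ p [].
rewrite (_ : [set _ | _] = sin_pos p `&` [set x | forall q, List.In q s -> sin_pos q x]).
  apply: measurableI; first by apply: sin_pos_measurable; apply: Fs; left.
  by apply: IH => q qs; apply: Fs; right.
apply/seteqP; split => x /=.
  by move=> H; split; [apply: H; left|move=> q qs; apply: H; right].
by move=> [H B] q [<-//|qs]; exact: B.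
Qed.

Lemma threshold_prod_integral_cvg mu s : (forall p, List.In p s -> F p.1) ->
  (\int[mu]_x (threshold_prod n s x)%:E @[n --> \oo] -->
   mu [set x | forall p, List.In p s -> sin_pos p x])%E.
Proof.
move=> Fs; set A := [set x | _].
have mA : measurable A by apply: sin_pos_pi_measurable; exists s.
rewrite -[X in mu X]setIT -(integral_indic mu measurableT mA).
have mt n : measurable_fun setT (threshold_prod n s).
  exact/trig_measurable/trig_threshold_prod.
have mt' n : measurable_fun setT (EFin \o threshold_prod n s) by exact/measurable_EFinP.
have mi : measurable_fun setT (EFin \o (\1_A : X -> R)).
  by apply/measurable_EFinP; exact: measurable_indic.
have ct : {ae mu, forall x, setT x ->
    (EFin \o threshold_prod n s) x @[n --> \oo] --> (EFin \o (\1_A : X -> R)) x}.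
  apply: aeW => x _; apply: cvg_EFin; first by near=> n.
  exact: threshold_prod_cvg.
have i1 : mu.-integrable setT (EFin \o (fun _ : X => 1%R : R)).
  by apply: (bounded_integrable mu (M := 1)) => [|x]; [exact: measurable_cst|rewrite normr1].
have bt : {ae mu, forall x, forall n : nat, setT x ->
    (`|(threshold_prod n s x)%:E| <= (EFin \o (fun _ : X => 1%R : R)) x)%E}.
  apply: aeW => x n _ /=; have /andP[h0 h1] := threshold_prod_itv n s x.
  by rewrite ger0_norm// lee_fin.
by have [_ _] := dominated_convergence measurableT mt' mi ct i1 bt.
Unshelve. all: by end_near. Qed.

Lemma sin_pos_pi_eq A : sin_pos_pi A -> P A = Q A.
Proof.
move=> [s [Fs ->]].
have cP := threshold_prod_integral_cvg (mu := P) Fs.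
have := threshold_prod_integral_cvg (mu := Q) Fs.
have -> : (fun n => \int[Q]_x (threshold_prod n s x)%:E)%E =
    (fun n => \int[P]_x (threshold_prod n s x)%:E)%E.
  by apply/funext => n; rewrite trig_integral//; exact: trig_threshold_prod.
by move=> cQ; exact: (cvg_unique _ cP cQ).
Qed.

Lemma sin_pos_pi_setI : setI_closed sin_pos_pi.
Proof.
move=> A B [s [Fs ->]] [t [Ft ->]]; exists (s ++ t); split.
  by move=> p /List.in_app_iff[/Fs|/Ft].
apply/seteqP; split => x /=.
  by move=> [hs ht] p /List.in_app_iff[/hs|/ht].
by move=> H; split => p ps; apply: H; apply/List.in_app_iff; [left|right].
Qed.

(** The set is the lower limit of the sets where sin((f - c)/(n+1)) > 0. The summand [0 * f x] only
    gives the scaled function the shape of [Flin]. *)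
Lemma gt_sin_pos_pi f (c : R) : F f -> <<s sin_pos_pi >> [set x | c < f x].
Proof.
move=> Ff; pose G n := sin_pos (fun x => n.+1%:R^-1 * f x + 0 * f x, n.+1%:R^-1 * c).
have E : [set x | c < f x] = \bigcup_m \bigcap_(n in [set n | (m <= n)%N]) G n.
  have GE n x : G n x = (0 < sin (n.+1%:R^-1 * (f x - c))).
    by rewrite /G /sin_pos /= mul0r addr0 mulrBr.
  apply/seteqP; split => x /=.
    rewrite -subr_gt0 => /sin_gt0_eventually[m _ Hm].
    by exists m => // n mn; rewrite GE; exact: Hm.
  move=> [m _ Hm]; rewrite -subr_gt0; apply/sin_gt0_eventually.
  by exists m => // n mn; rewrite /= -GE; exact: Hm.
rewrite E; pose T : measurableType _ := g_sigma_algebraType sin_pos_pi.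
apply: (@bigcupT_measurable _ T) => m.
apply: (@bigcap_measurableType _ T) => n _.
apply: sub_sigma_algebra; exists [:: (fun x => n.+1%:R^-1 * f x + 0 * f x, n.+1%:R^-1 * c)].
split; first by move=> p [<-|//]; exact: Flin.
by apply/seteqP; split => x /=; [move=> Gx p [<-|//]|apply; left].
Qed.

Lemma probability_eq_trig A : <<s sin_pos_pi >> A -> P A = Q A.
Proof.
apply: (@g_sigma_algebra_measure_unique _ R X sin_pos_pi sin_pos_pi_measurable
  (fun=> setT)).
- move=> _; exists [::]; split => //.
  by apply/seteqP; split => // x _ p [].
- by rewrite bigcup_const//; exists 0%N.
- exact: sin_pos_pi_setI.
- exact: sin_pos_pi_eq.
- by move=> _; rewrite (le_lt_trans (probability_le1 _ _))// ltry.
Qed.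

End CharacteristicFunctional.

(** * Uniqueness of laws on D' and conclusion *)

Section DistributionUniqueness.
Set Implicit Arguments.
Unset Strict Implicit.
Context {R : realType} {d : nat}.

HB.instance Definition _ := isMeasurableFun.Build _ _ _ _
  (@restriction R d) measurable_restriction.

Definition evalD_set : set (DprimeM R d -> R) :=
  [set f | exists2 phi, isD phi & f = (fun u => proj1_sig u phi)].

(** Linearity of distributions enters here; it is what lets integrals of single pairings determine
    those of products. *)
Lemma evalD_set_lin (a b : R) f g : evalD_set f -> evalD_set g ->
  evalD_set (fun u => a * f u + b * g u).
Proof.
move=> [phi Dphi ->] [psi Dpsi ->].
exists (fun x => a * phi x + b * psi x); first exact: isD_lin.
by apply/funext => u; have [_ lu _] := proj2_sig u; rewrite lu.
Qed.

Lemma cylD_sin_pos_pi : @cylD R d `<=` <<s sin_pos_pi evalD_set >>.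
Proof.
move=> _ [N [phi [B [Dphi bB ->]]]].
(* Pairings are measured against the sigma-algebra generated by the pi-system instead of the
   cylinders, so [measurable_row] places each cylinder in it. *)
pose T : measurableType _ := g_sigma_algebraType (sin_pos_pi evalD_set).
have m i : measurable_fun setT (fun u : T => proj1_sig u (phi i)).
  by apply: measurable_fun_gt => c; apply: (gt_sin_pos_pi evalD_set_lin c); exists (phi i).
exact: (@measurable_row R _ T N (fun i u => proj1_sig u (phi i)) m B bB).
Qed.

Lemma Dprime_probability_eq (P Q : probability (DprimeM R d) R) :
  (forall phi, isD phi ->
    (\int[P]_u (cos (proj1_sig u phi))%:E = \int[Q]_u (cos (proj1_sig u phi))%:E)%E) ->
  (forall phi, isD phi ->
    (\int[P]_u (sin (proj1_sig u phi))%:E = \int[Q]_u (sin (proj1_sig u phi))%:E)%E) ->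
  forall A, measurable A -> P A = Q A.
Proof.
move=> Ec Es A mA; apply: (@probability_eq_trig _ _ _ P Q evalD_set).
- exists (fun=> 0); first exact: isD0.
  apply/funext => u; have [_ lu _] := proj2_sig u.
  by have := linear_onB lu isD0 isD0; rewrite !subrr.
- exact: evalD_set_lin.
- by move=> _ [phi Dphi ->]; exact: measurable_evalD.
- by move=> _ [phi Dphi ->]; exact: Ec.
- by move=> _ [phi Dphi ->]; exact: Es.
apply: (smallest_sub _ cylD_sin_pos_pi mA).
exact: smallest_sigma_algebra.
Qed.

Lemma integral_restriction (PS : probability (SprimeM R d) R) (h : R -> R) phi :
  measurable_fun setT h -> (forall t, `|h t| <= 1) -> isD phi ->
  (\int[distribution PS (@restriction R d)]_u (h (proj1_sig u phi))%:E =
   \int[PS]_w (h (proj1_sig w phi))%:E)%E.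
Proof.
move=> mh h1 Dphi.
have mS : measurable_fun setT (fun w : SprimeM R d => h (proj1_sig w phi)).
  exact: (measurableT_comp mh (measurable_evalS (isD_isS Dphi))).
have mD : measurable_fun setT (fun u : DprimeM R d => h (proj1_sig u phi)).
  exact: (measurableT_comp mh (measurable_evalD Dphi)).
have E : (fun w : SprimeM R d => (h (proj1_sig w phi))%:E) =
    (fun u : DprimeM R d => (h (proj1_sig u phi))%:E) \o (@restriction R d).
  by apply/funext => w; rewrite /= /restrictD asboolT.
rewrite integral_distribution ?E//; first exact/measurable_EFinP.
by rewrite -E; exact: (bounded_integrable PS mS).
Qed.

End DistributionUniqueness.

Theorem theorem3p8 (R : realType) (d : nat)
  (mu sigma2 : R) (V : {measure set R -> \bar R})
  (PD : probability (DprimeM R d) R) (PS : probability (SprimeM R d) R) :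
  0 <= sigma2 -> levy_measure V -> in_M0plus2 V ->
  (forall phi, isD phi ->
     let a := int_Rd (fun r => levy_re sigma2 V (phi r)) in
     let b := int_Rd (fun r => levy_im mu V (phi r)) in
     (\int[PD]_u (cos (proj1_sig u phi))%:E = (expR a * cos b)%:E)%E /\
     (\int[PD]_u (sin (proj1_sig u phi))%:E = (expR a * sin b)%:E)%E) ->
  (forall phi, isS phi ->
     let a := int_Rd (fun r => levy_re sigma2 V (phi r)) in
     let b := int_Rd (fun r => levy_im mu V (phi r)) in
     (\int[PS]_u (cos (proj1_sig u phi))%:E = (expR a * cos b)%:E)%E /\
     (\int[PS]_u (sin (proj1_sig u phi))%:E = (expR a * sin b)%:E)%E) ->
  (forall A : set (SprimeM R d), measurable A ->
     measurable (embed_image A) /\ PD (embed_image A) = PS A) /\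
  PD (embed_image [set: SprimeM R d]) = 1%E /\
  PD (~` embed_image [set: SprimeM R d]) = 0%E.
Proof.
move=> _ _ _ HD HS.
pose Q : probability (DprimeM R d) R := distribution PS (@restriction R d).
have mcos : measurable_fun setT (@cos R).
  by apply: continuous_measurable_fun; exact: continuous_cos.
have msin : measurable_fun setT (@sin R).
  by apply: continuous_measurable_fun; exact: continuous_sin.
have PQ : forall A, measurable A -> PD A = Q A.
  apply: Dprime_probability_eq => phi Dphi.
    rewrite (integral_restriction PS mcos (@cos_norm_le1 R) Dphi).
    by rewrite (HD phi Dphi).1 (HS phi (isD_isS Dphi)).1.
  rewrite (integral_restriction PS msin (@sin_norm_le1 R) Dphi).
  by rewrite (HD phi Dphi).2 (HS phi (isD_isS Dphi)).2.
have main A : measurable A -> measurable (embed_image A) /\ PD (embed_image A) = PS A.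
  move=> mA; have mE := measurable_embed_image mA; split=> //.
  (* Under [Q] the image of [A] has the [PS]-mass of its preimage by restriction, which is [A] by
     injectivity. *)
  by rewrite PQ// -[in RHS](restriction_embed A).
have [mT PT] := main _ measurableT.
rewrite probability_setT in PT.
split; [exact: main|split; [exact: PT|]].
by rewrite probability_setC// PT subee.
Qed.
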